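(* Let $N=m+n\to\infty$ with $m/N\to r\in(0,1)$, and let $G=G_N$ be a simple undirected graph on the nodes $\{1,\dots,N\}$ for each $N$. Suppose that, as $N\to\infty$, $\sum_{i=1}^N |G_i|^2=o(|G|^{1.5})$ and $N_{sq}=o(|G|^2)$. Then, under the permutation null distribution, the weighted edge-count statistic $Z_w^P$ converges in distribution to $N(0,1)$.
   Context: Graph notation. $G$ denotes both the graph on nodes $\{1,\dots,N\}$ (simple: no duplicate edges, no loops; undirected) and its edge set; $|\cdot|$ is cardinality, so $|G|$ is the number of edges. $G_i$ is the set of edges having node $i$ as an endpoint (so $|G_i|$ is the degree of $i$). $N_{sq}$ is the number of squares (4-cycles) in $G$. $a_N=o(b_N)$ means $\lim_{N\to\infty}a_N/b_N=0$. Permutation null distribution. The graph is fixed; the labels $(g_1,\dots,g_N)\in\{1,2\}^N$ are random: each choice of $m$ of the $N$ nodes to receive label $1$ (sample X), the remaining $n=N-m$ nodes receiving label $2$ (sample Y), has probability $1/\binom{N}{m}$. $\mathsf E_P$, $\mathsf{Var}_P$ denote expectation and variance under this distribution. Statistic. For $j=1,2$, $R_j$ is the number of edges of $G$ both of whose endpoints have label $j$. Let $$R_w=\frac{n-1}{N-2}R_1+\frac{m-1}{N-2}R_2,\qquad Z_w^P=\frac{R_w-\mathsf E_P(R_w)}{\sqrt{\mathsf{Var}_P(R_w)}}.$$ *)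

(* Defs.v *)
From mathcomp Require Import all_boot all_order all_algebra.
From mathcomp Require Import all_classical all_reals all_analysis.

Set Implicit Arguments.
Unset Strict Implicit.
Unset Printing Implicit Defensive.

Import Order.TTheory GRing.Theory Num.Theory.
Import numFieldNormedType.Exports.

Local Open Scope ring_scope.

(* A graph on the N nodes 'I_N is identified with its set of edges, an edge
   being the two-element set of its endpoints. *)
Definition graph (N : nat) := {set {set 'I_N}}.

Definition simple_graph (N : nat) (G : graph N) : Prop :=
  forall e : {set 'I_N}, e \in G -> #|e| = 2%N.

Definition incident (N : nat) (G : graph N) (i : 'I_N) : graph N :=
  [set e in G | i \in e]%SET.

Definition is_square (N : nat) (C : graph N) : bool :=
  [exists a : 'I_N, exists b : 'I_N, exists c : 'I_N, exists d : 'I_N,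
     uniq [:: a; b; c; d] &&
     (C == [set [set a; b]; [set b; c]; [set c; d]; [set d; a]]%SET)].

(* Squares are not required to be induced, and each one is counted once. *)
Definition num_squares (N : nat) (G : graph N) : nat :=
  #|[set C : graph N | (C \subset G) && is_square C]%SET|.

(* A labelling is encoded by the set X of the nodes with label 1; the nodes of
   ~: X have label 2. *)
Definition perm_E (R : realType) (N m : nat) (f : {set 'I_N} -> R) : R :=
  \sum_(X : {set 'I_N} | #|X| == m) 'C(N, m)%:R^-1 * f X.

Definition perm_Var (R : realType) (N m : nat) (f : {set 'I_N} -> R) : R :=
  perm_E m (fun X => (f X - perm_E m f) ^+ 2).

Definition perm_Pr (R : realType) (N m : nat) (A : pred {set 'I_N}) : R :=
  perm_E m (fun X => (A X)%:R).

Definition edges_within (N : nat) (G : graph N) (S : {set 'I_N}) : nat :=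
  #|[set e in G | e \subset S]%SET|.

Definition R_w (R : realType) (N m n : nat) (G : graph N) (X : {set 'I_N}) : R :=
  (n%:R - 1) / (N%:R - 2) * (edges_within G X)%:R +
  (m%:R - 1) / (N%:R - 2) * (edges_within G (~: X)%SET)%:R.

Definition Z_w (R : realType) (N m n : nat) (G : graph N) (X : {set 'I_N}) : R :=
  (R_w R m n G X - perm_E m (R_w R m n G)) / Num.sqrt (perm_Var m (R_w R m n G)).

(* [a N / b N --> 0] with the quotient meaningful: since x / 0 = 0 in MathComp,
   [b] must be required to be eventually nonzero. *)
Definition is_little_o (R : realType) (a b : nat -> R) : Prop :=
  (\forall N \near \oo, b N != 0)%classic /\
  (a N / b N @[N --> \oo] --> (0 : R))%classic.

Definition cdf_of (R : realType) (mu : probability (measurableTypeR R) R) (t : R) : R :=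
  fine (mu `]-oo, t]%classic).

(* The variables may live on different probability spaces, so convergence in
   distribution is stated on their distribution functions [F N]. *)
Definition cvg_in_distribution (R : realType) (F : nat -> R -> R)
    (mu : probability (measurableTypeR R) R) : Prop :=
  forall t : R, {for t, continuous (cdf_of mu)} ->
    (F N t @[N --> \oo] --> cdf_of mu t)%classic.

(* Main.v *)
Require Import Defs.
From mathcomp Require Import all_boot all_order all_algebra.
From mathcomp Require Import perm.
From mathcomp Require Import all_classical all_reals all_analysis.
From mathcomp Require Import measurable_realfun.
From mathcomp Require Import ring lra zify.
From HB Require Import structures.

Import Order.TTheory GRing.Theory Num.Theory.
Import numFieldNormedType.Exports.

Local Open Scope ring_scope.

(** Write [p = m/N] and let [x_i] be the label indicator of node [i] minus [p].
The proof is Stein's method of exchangeable pairs, carried out directly on the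
uniform m-subsets; the pair is obtained by exchanging the labels of two nodes.

The weights of [R_w] are exactly those for which the centred statistic
[V = R_w - E R_w] is an eigenfunction of this exchange: summed over all ordered
pairs of nodes, the increments of [V] give [-4(N-1)V] ([sum_form_incr]).  Since
an exchange preserves the uniform distribution, it follows for every function
[F] that [8(N-1) E(V F)] is the expected sum of the products of the increments
of [V] and of [F] ([stein_identity]).  With [F = V] this gives the variance
[sigma2] of [V]; with [F = f(V/sigma)] and a Taylor expansion of [f] it gives
[stein_bound]: for the solution [f] of the Stein equation
[f'(z) - z f(z) = h(z) - c] attached to a test function [h] of Gaussian mean
[c], the error [|E h(V/sigma) - c|] is at most a constant times the sum of

 - the relative [L1] deviation of the sum of the squared increments from
   [8(N-1) p^2 (1-p)^2 |G|], and
 - the normalised expected sum of the cubed increments.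

No formula for the variance is used: the first term also controls the distance
of [sigma2] from [p^2 (1-p)^2 |G|].

To estimate the two terms, the squared increments are expanded
([sum_form_incr_sqr], [sum_rowsum_sqr]) into the constant [8 N p^2 (1-p)^2 |G|],
multilinear polynomials in the [x_i] of degree at most 3, and terms of smaller
order.  The labels are dependent, but only weakly: the relation
[sum_i x_i = 0] gives a recursion for mixed moments which shows that each pair
of distinct singleton factors costs a factor [O(1/N)] ([moment_bound]), and a
Schur test then bounds the second moment of such a polynomial by a constant
times the sum of the squares of its coefficients, as for independent labels
([slice_linear], [slice_quadratic], [slice_cubic]).  The squared coefficients
count subgraphs: edges, paths of length two, whose number is at most the sum of
the squared degrees, and, for the coefficients
[codeg j k = #{i adjacent to j and k}], pairs of such paths with the same
endpoints, which are squares of [G] or coincide ([codeg_sqr_sum]).  The two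
hypotheses of the theorem make these fluctuations negligible against [|G|]; the
cubed increments are controlled by the degrees alone ([E_swap_incr3]).

On the analytic side, [h] is a piecewise linear function lying between the
indicators of two half-lines, for which the Stein equation is solved explicitly
by means of the Gaussian distribution function; the needed bounds on [f] and
[f'] come from Mills ratio estimates in the tails and from compactness in
between ([stein_solution]).  Sandwiching the indicator of a half-line between
two such functions gives convergence of the distribution functions. *)

Set Implicit Arguments.
Unset Strict Implicit.
Unset Printing Implicit Defensive.

(** * Mean value estimates on the real line *)

Section Calculus.
Variable R : realType.
Implicit Types f df g : R -> R.

Lemma is_derive_continuous f df :
  (forall x : R, is_derive x 1 f (df x)) -> continuous f.
Proof.
move=> fE x; apply: differentiable_continuous; apply/derivable1_diffP.
by have [] := fE x.
Qed.

Lemma is_derive_MVT f df (x y : R) :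
  (forall z : R, is_derive z 1 f (df z)) -> x <= y ->
  exists2 z, x <= z <= y & f y - f x = df z * (y - x).
Proof.
move=> fE xy.
have [|z zxy ->] := @MVT_segment R f df x y xy (fun z _ => fE z).
  exact: continuous_subspaceT (is_derive_continuous fE).
by exists z => //; move: zxy; rewrite in_itv.
Qed.

Lemma is_derive_ndecr f df (x y : R) :
  (forall z : R, is_derive z 1 f (df z)) -> x <= y ->
  (forall z, x <= z <= y -> 0 <= df z) -> f x <= f y.
Proof.
move=> fE xy df0; have [z /df0 h0 fxy] := is_derive_MVT fE xy.
by rewrite -subr_ge0 fxy mulr_ge0 // subr_ge0.
Qed.

Lemma is_derive_lipschitz f df (B x y : R) :
  (forall z : R, is_derive z 1 f (df z)) ->
  (forall z, `|df z| <= B) -> `|f y - f x| <= B * `|y - x|.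
Proof.
move=> fE dfB; wlog xy : x y / x <= y => [H|].
  have [/H //|/ltW/H] := leP x y.
  by rewrite distrC => /le_trans; apply; rewrite distrC.
have [z _ ->] := is_derive_MVT fE xy.
by rewrite normrM ler_wpM2r.
Qed.

Lemma continuous_bounded (a b : R) f : continuous f ->
  exists2 B : R, 0 <= B & forall x, a <= x <= b -> `|f x| <= B.
Proof.
move=> cf; have [ba|ab] := ltP b a.
  by exists 0 => // x /andP[ax xb]; have := le_lt_trans (le_trans ax xb) ba; rewrite ltxx.
have cg : {within `[a, b], continuous (fun x => `|f x|)}%classic.
  apply: continuous_subspaceT => x.
  by apply: (continuous_comp (cf x)); exact: norm_continuous.
have [c _ hc] := EVT_max ab cg.
by exists `|f c| => // x xab; apply: hc; rewrite in_itv.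
Qed.

End Calculus.

(** * The Gaussian density, distribution function and Mills ratio *)

Section Gaussian.
Variable R : realType.

Definition phi : R -> R := normal_pdf 0 1.
Definition Phi : R -> R := cdf_of (normal_prob 0 1).

Lemma phiE x : phi x = normal_peak 1 * expR (- (x ^+ 2 / 2)).
Proof.
rewrite /phi normal_pdfE ?oner_eq0 //= /normal_fun subr0 expr1n.
by rewrite mulNr.
Qed.

Lemma phi_gt0 x : 0 < phi x.
Proof. by rewrite phiE mulr_gt0 ?expR_gt0 // normal_peak_gt0 // oner_eq0. Qed.

Lemma phi_neq0 x : phi x != 0.
Proof. by rewrite gt_eqF // phi_gt0. Qed.

Lemma phiN x : phi (- x) = phi x.
Proof. by rewrite !phiE sqrrN. Qed.

Lemma is_derive_phi (x : R) : is_derive x 1 phi (- x * phi x).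
Proof.
have -> : phi = fun x => normal_peak 1 * expR (- (x ^+ 2 / 2)).
  by apply/funext => y; rewrite phiE.
have d1 : is_derive x 1 (fun y : R => - (y ^+ 2 / 2)) (- x).
  apply: is_derive_eq; rewrite /= !scaler0 ?scaler1 ?expr1 ?addr0 ?add0r /GRing.scale /=.
  lra.
have d2 := @is_derive1_comp _ expR _ x _ _ (is_derive_expR _) d1.
have d3 : is_derive x 1 (normal_peak 1 *: (expR \o (fun y : R => - (y ^+ 2 / 2))))
   (normal_peak 1 *: (expR (- (x ^+ 2 / 2)) * - x)).
  exact: is_deriveZ.
apply: (is_derive_eq d3).
rewrite /GRing.scale /=; ring.
Qed.

Lemma continuous_phi : continuous phi.
Proof. exact: is_derive_continuous is_derive_phi. Qed.

Lemma is_derive_Phi (x : R) : is_derive x 1 Phi (phi x).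
Proof.
have xx1 : x < x + 1 by rewrite ltrDl.
have int : lebesgue_measure.-integrable [set` Interval -oo%O (BRight (x + 1))]
    (EFin \o phi).
  by apply: (integrableS _ _ (subsetT _)) => //; exact: integrable_normal_pdf.
have [d e] := continuous_FTC1 xx1 int (ltNyr _) (@continuous_phi x).
split; [exact: d|by rewrite -derive1E; exact: e].
Qed.

Lemma continuous_Phi : continuous Phi.
Proof. exact: is_derive_continuous is_derive_Phi. Qed.

Lemma Phi_ge0 x : 0 <= Phi x.
Proof. exact: fine_ge0. Qed.

Lemma Phi_le1 x : Phi x <= 1.
Proof.
rewrite /Phi /cdf_of -lee_fin fineK; first exact: probability_le1.
by rewrite fin_num_measure.
Qed.

End Gaussian.
Arguments phi {R} x.
Arguments Phi {R} x.

Section PhiLimits.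
Variable R : realType.

Let idTR : measurableTypeR R -> R := idfun.

#[local] HB.instance Definition _ :=
  @isMeasurableFun.Build _ _ _ _ idTR (@measurable_id _ _ setT).

Let PhiE : Phi = fine \o cdf (idTR : {RV (normal_prob 0 1) >-> R}).
Proof. by apply/funext => x; rewrite /= /cdf /distribution /pushforward /= preimage_id. Qed.

Lemma cvg_Phi_Ny : (Phi x @[x --> -oo] --> (0 : R))%classic.
Proof.
rewrite PhiE; exact: fine_cvg (cvg_cdfNy0 (idTR : {RV (normal_prob 0 1) >-> R})).
Qed.

Lemma cvg_Phi_y : (Phi x @[x --> +oo] --> (1 : R))%classic.
Proof.
rewrite PhiE; exact: fine_cvg (cvg_cdfy1 (idTR : {RV (normal_prob 0 1) >-> R})).
Qed.

Lemma is_derive_comp_opp (f : R -> R) (d : R) (x : R) :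
  is_derive (- x) 1 f d -> is_derive x 1 (fun y => f (- y)) (- d).
Proof.
move=> fd; have h : is_derive x 1 (fun y : R => - y) (-1) by apply: is_derive_eq.
have := @is_derive1_comp _ f (fun y => - y) x _ _ fd h.
by rewrite mulrN1.
Qed.

(** [Phi x + Phi (- x)] has derivative [phi x - phi (- x) = 0], and tends to 1 at
infinity. *)
Lemma PhiN (x : R) : Phi (- x) = 1 - Phi x.
Proof.
pose s (y : R) := Phi y + Phi (- y).
have ds (y : R) : is_derive y 1 s 0.
  have -> : 0 = phi y + - phi (- y) :> R by rewrite phiN subrr.
  apply: (@is_deriveD _ _ _ Phi (fun y => Phi (- y))).
    exact: is_derive_Phi.
  by apply: is_derive_comp_opp; exact: is_derive_Phi.
have sE (y : R) : s y = s 0.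
  apply/eqP; rewrite -subr_eq0 -normr_le0.
  have := @is_derive_lipschitz R s (fun=> 0) 0 0 y ds.
  by rewrite mul0r; apply => z; rewrite normr0.
have : (s y @[y --> +oo] --> (1 + 0 : R))%classic.
  apply: cvgD; first exact: cvg_Phi_y.
  have /cvgNy_compNP := cvg_Phi_Ny; exact.
have h : (s y @[y --> +oo] --> s 0)%classic.
  have -> : s = (fun=> s 0) by apply/funext => y; rewrite sE.
  exact: cvg_cst.
move=> /(cvg_unique (@Rhausdorff R) h); rewrite addr0 => s0.
by have := sE x; rewrite s0 /s => <-; rewrite addrAC subrr add0r.
Qed.

(** The decay rate matters little: any bound tending to 0 makes the boundary
terms at minus infinity vanish below.  This one comes from
[expR (x ^+ 2 / 4) >= x ^+ 2 / 4], squared. *)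
Lemma sqr_phi_le (x : R) : x != 0 -> x ^+ 2 * phi x <= 16 * normal_peak 1 / x ^+ 2.
Proof.
move=> x0; have x2 : 0 < x ^+ 2 by rewrite exprn_even_gt0.
rewrite phiE expRN mulrCA -mulrA [leRHS]mulrCA ler_pM2l; last first.
  by rewrite normal_peak_gt0 // oner_eq0.
rewrite ler_pdivrMr ?expR_gt0 // mulrAC ler_pdivlMr // .
have h : x ^+ 2 / 4 <= expR (x ^+ 2 / 4).
  by apply: le_trans (expR_ge1Dx _); rewrite lerDr.
have -> : x ^+ 2 / 2 = x ^+ 2 / 4 + x ^+ 2 / 4 by lra.
rewrite expRD.
have h0 : 0 <= x ^+ 2 / 4 by lra.
have := ler_pM h0 h0 h h; set E := expR _; nra.
Qed.

Lemma cvg_sqr_phi_Ny : (x ^+ 2 * phi x @[x --> -oo] --> (0 : R))%classic.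
Proof.
apply/cvgrPdist_le => e e0; near=> x.
have x1 : x <= -1 by near: x; apply: nbhs_ninfty_le; rewrite num_real.
have xe : x <= - (16 * normal_peak 1 / e) by near: x; apply: nbhs_ninfty_le; rewrite num_real.
have p0 : 0 < normal_peak (1 : R) by rewrite normal_peak_gt0 // oner_eq0.
rewrite sub0r normrN ger0_norm; last by rewrite mulr_ge0 ?sqr_ge0 // ltW // phi_gt0.
have x0 : x != 0 by rewrite lt_eqF //; lra.
apply: (le_trans (sqr_phi_le x0)).
rewrite ler_pdivrMr ?exprn_even_gt0 //.
have : 16 * normal_peak 1 <= - x * e by rewrite -ler_pdivrMr // lerNr.
by move=> h; apply: (le_trans h); rewrite mulrC ler_pM2l // expr2; nra.
Unshelve. all: by end_near. Qed.

(** Used to integrate an inequality from minus infinity without integrals: a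
function that increases from the limit 0 is nonnegative. *)
Lemma ge0_of_ndecr_cvgNy (u : R -> R) (du : R -> R) :
  (forall x : R, is_derive x 1 u (du x)) -> (forall x, x <= -1 -> 0 <= du x) ->
  (u x @[x --> -oo] --> (0 : R))%classic -> forall x, x <= -1 -> 0 <= u x.
Proof.
move=> uE du0 u0 x x1; apply: cvgr_to_le u0 _; near=> y.
have yx : y <= x by near: y; apply: nbhs_ninfty_le; rewrite num_real.
apply: (is_derive_ndecr uE yx) => z /andP[_ zx]; apply: du0; exact: le_trans x1.
Unshelve. all: by end_near. Qed.

Lemma cvgNy0_dominated (u : R -> R) (C : R) :
  (forall x, x <= -1 -> `|u x| <= C * (x ^+ 2 * phi x)) ->
  (u x @[x --> -oo] --> (0 : R))%classic.
Proof.
move=> uC; apply/norm_cvg0P.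
have h : (C * (x ^+ 2 * phi x) @[x --> -oo] --> (0 : R))%classic.
  by rewrite -(mulr0 C); apply: cvgMr; exact: cvg_sqr_phi_Ny.
apply: (squeeze_cvgr _ (cvg_cst 0) h); near=> x; rewrite normr_ge0 /=; apply: uC.
by near: x; apply: nbhs_ninfty_le; rewrite num_real.
Unshelve. all: by end_near. Qed.

(** The derivative of [phi - Phi] is [(- x - 1) * phi x], which is nonnegative
left of -1. *)
Lemma Phi_le_phi (x : R) : x <= -1 -> Phi x <= phi x.
Proof.
move=> x1; rewrite -subr_ge0.
apply: (@ge0_of_ndecr_cvgNy (fun x => phi x - Phi x) (fun x => - x * phi x - phi x)) => //.
- move=> y; apply: (@is_deriveB _ _ _ phi Phi); [exact: is_derive_phi|exact: is_derive_Phi].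
- by move=> y y1; have := phi_gt0 y; nra.
- rewrite -(subrr 0); apply: cvgB; last exact: cvg_Phi_Ny.
  apply: (@cvgNy0_dominated _ 1) => y y1.
  rewrite ger0_norm ?(ltW (phi_gt0 _)) // mul1r.
  by rewrite ler_pMl ?phi_gt0 //; nra.
Qed.

(** [Phi1] and [Phi2 / 2] are the first and second iterated antiderivatives of
[Phi] from minus infinity.  Their nonnegativity bounds the Mills
ratio [Phi / phi] above and below.  Up to a constant factor, [Phi / phi] solves
the Stein equation in the left tail, [Phi1 / phi] is its derivative, and
[Phi2 / phi] is the derivative of [x * Phi x / phi x]. *)
Definition Phi1 (x : R) := x * Phi x + phi x.
Definition Phi2 (x : R) := (1 + x ^+ 2) * Phi x + x * phi x.

Lemma is_derive_Phi1 (x : R) : is_derive x 1 Phi1 (Phi x).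
Proof.
have h1 : is_derive x 1 (id * Phi) (x *: phi x + Phi x *: 1).
  by apply: is_deriveM; exact: is_derive_Phi.
apply: (is_derive_eq (is_deriveD h1 (is_derive_phi x))).
by rewrite /GRing.scale /=; ring.
Qed.

Lemma is_derive_Phi2 (x : R) : is_derive x 1 Phi2 (2 * Phi1 x).
Proof.
have h0 : is_derive x 1 (fun x : R => 1 + x ^+ 2) (2 * x).
  by apply: is_derive_eq; rewrite add0r /GRing.scale /= mulr1 mulr_natl mul1r mulr2n.
have h1 := is_deriveM h0 (is_derive_Phi x).
have h2 : is_derive x 1 (id * phi) (x *: (- x * phi x) + phi x *: 1).
  by apply: is_deriveM; exact: is_derive_phi.
apply: (is_derive_eq (is_deriveD h1 h2)).
by rewrite /Phi1 /GRing.scale /=; ring.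
Qed.

Lemma Phi1_ge0 x : x <= -1 -> 0 <= Phi1 x.
Proof.
apply: ge0_of_ndecr_cvgNy is_derive_Phi1 _ _ x => [x _|]; first exact: Phi_ge0.
apply: (@cvgNy0_dominated _ 2) => x x1; rewrite /Phi1.
have h1 := Phi_le_phi x1; have h2 := Phi_ge0 x; have h3 := phi_gt0 x.
have e1 : x * Phi x <= 0 by rewrite mulr_le0_ge0 //; lra.
have e2 : x * phi x <= x * Phi x by rewrite ler_wnM2l //; lra.
have e0 : 1 <= x ^+ 2 by nra.
have e3 : phi x <= x ^+ 2 * phi x by rewrite ler_peMl // ltW.
have e4 : - x * phi x <= x ^+ 2 * phi x by apply: ler_wpM2r; [exact: ltW|nra].
by rewrite ler_norml; apply/andP; split; lra.
Qed.

Lemma Phi2_ge0 x : x <= -1 -> 0 <= Phi2 x.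
Proof.
apply: ge0_of_ndecr_cvgNy is_derive_Phi2 _ _ x => [x x1|].
  by rewrite mulr_ge0 // Phi1_ge0.
apply: (@cvgNy0_dominated _ 3) => x x1; rewrite /Phi2.
have h1 := Phi_le_phi x1; have h2 := Phi_ge0 x; have h3 := phi_gt0 x.
have e1 : x * Phi x <= 0 by rewrite mulr_le0_ge0 //; lra.
have e2 : x * phi x <= x * Phi x by rewrite ler_wnM2l //; lra.
have e0 : 1 <= x ^+ 2 by nra.
have e3 : phi x <= x ^+ 2 * phi x by rewrite ler_peMl // ltW.
have e4 : - x * phi x <= x ^+ 2 * phi x by apply: ler_wpM2r; [exact: ltW|nra].
have e5 : x ^+ 2 * Phi x <= x ^+ 2 * phi x by rewrite ler_wpM2l ?sqr_ge0.
have e6 : 0 <= x ^+ 2 * Phi x by rewrite mulr_ge0 ?sqr_ge0.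
by rewrite ler_norml; apply/andP; split; lra.
Qed.

Lemma Phi1_le x : x <= -1 -> Phi1 x <= phi x.
Proof. by move=> x1; rewrite /Phi1; have := Phi_ge0 x; nra. Qed.

Lemma Phi2_le x : x <= -1 -> Phi2 x <= phi x.
Proof.
move=> x1; have := Phi1_ge0 x1; have := Phi_le_phi x1 => h1 h2.
have -> : Phi2 x = Phi x + x * Phi1 x by rewrite /Phi1 /Phi2; ring.
nra.
Qed.

End PhiLimits.

(** * Solving the Stein equation *)

Section SteinSolution.
Variables (R : realType) (a b : R).
Hypothesis ab : a < b.

(** A Lipschitz test function, equal to 1 left of [a] and to 0 right of [b]. *)
Definition ramp (x : R) := Num.max 0 (Num.min 1 ((b - x) / (b - a))).

Lemma ramp_ge0 x : 0 <= ramp x. Proof. by rewrite le_max lexx. Qed.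

Lemma ramp_le1 x : ramp x <= 1.
Proof. by rewrite ge_max ler01 ge_min lexx. Qed.

Lemma ramp_left x : x <= a -> ramp x = 1.
Proof.
move=> xa; rewrite /ramp min_l ?max_r //.
by rewrite ler_pdivlMr ?subr_gt0 // mul1r lerB.
Qed.

Lemma ramp_right x : b <= x -> ramp x = 0.
Proof.
move=> bx; rewrite /ramp max_l // ge_min; apply/orP; right.
by rewrite pmulr_lle0 ?invr_gt0 ?subr_gt0 // subr_le0.
Qed.

Lemma ramp_bounds (x : R) : (x <= a)%R%:R <= ramp x <= (x <= b)%R%:R.
Proof.
apply/andP; split.
  by case: (leP x a) => [/ramp_left ->|_] //; exact: ramp_ge0.
by case: (leP x b) => [_|/ltW/ramp_right ->] //; exact: ramp_le1.
Qed.

Lemma ramp_lipschitz x y : `|ramp y - ramp x| <= (b - a)^-1 * `|y - x|.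
Proof.
wlog xy : x y / x <= y => [H|].
  have [/H //|/ltW/H] := leP x y; by rewrite distrC => /le_trans; apply; rewrite distrC.
have ba : 0 < (b - a)^-1 by rewrite invr_gt0 subr_gt0.
rewrite (ger0_norm (_ : 0 <= y - x)) ?subr_ge0 //.
have E : (b - x) / (b - a) = (b - y) / (b - a) + (b - a)^-1 * (y - x) by ring.
have h : 0 <= (b - a)^-1 * (y - x) by rewrite mulr_ge0 ?(ltW ba) ?subr_ge0.
rewrite /ramp E; move: h; set d := _ * (y - x); set u := (b - y) / _ => h.
clearbody d u; clear E; rewrite ler_norml.
have [|] := lerP 1 u; have [|] := lerP 1 (u + d) => h1 h2;
  rewrite ?(min_l h1) ?(min_l h2) ?(min_r (ltW h1)) ?(min_r (ltW h2)).
- by rewrite subrr; apply/andP; split; lra.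
- by lra.
- have [|] := lerP 0 u; have [|] := lerP 0 (1 : R) => h3 h4;
    rewrite ?(max_r h3) ?(max_r h4) ?(max_l (ltW h3)) ?(max_l (ltW h4));
    apply/andP; split; lra.
have [|] := lerP 0 u; have [|] := lerP 0 (u + d) => h3 h4;
  rewrite ?(max_r h3) ?(max_r h4) ?(max_l (ltW h3)) ?(max_l (ltW h4)); apply/andP; split; lra.
Qed.

Lemma ramp_continuous : continuous ramp.
Proof.
have -> : ramp = cst 0 \max (cst 1 \min (fun x => (b - x) / (b - a))) by [].
move=> x; apply: continuous_max; first exact: cvg_cst.
apply: continuous_min; first exact: cvg_cst.
apply: cvgM; last exact: cvg_cst.
by apply: cvgB; [exact: cvg_cst|exact: cvg_id].
Qed.

(** The antiderivative of [ramp * phi]: it coincides with [Phi] left of [a] and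
is constant right of [b], where its value is the Gaussian mean of [ramp]. *)
Definition smooth_cdf (x : R) : R :=
  \int[lebesgue_measure]_(t in [set` `]-oo, x]]) (ramp t * phi t).

Let dens t := ramp t * phi t.

Lemma continuous_dens : continuous dens.
Proof. by move=> x; apply: cvgM; [exact: ramp_continuous|exact: continuous_phi]. Qed.

Lemma integrable_dens : lebesgue_measure.-integrable [set: R] (EFin \o dens).
Proof.
refine (@le_integrable _ _ R (@lebesgue_measure R) setT measurableT
  (EFin \o dens) (EFin \o phi) _ _ _).
- by apply/measurable_EFinP; exact: continuous_measurable_fun continuous_dens.
- move=> x _ /=; rewrite lee_fin /dens normrM ler_piMl //.
  by rewrite ger0_norm ?ramp_ge0 ?ramp_le1.
- exact: integrable_normal_pdf.
Qed.

Lemma is_derive_smooth_cdf (x : R) : is_derive x 1 smooth_cdf (dens x).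
Proof.
have xx1 : x < x + 1 by rewrite ltrDl.
have int : lebesgue_measure.-integrable [set` Interval -oo%O (BRight (x + 1))]
    (EFin \o dens).
  by apply: (integrableS _ _ (subsetT _)) => //; exact: integrable_dens.
have [d e] := continuous_FTC1 xx1 int (ltNyr _) (@continuous_dens x).
split; [exact: d|by rewrite -derive1E; exact: e].
Qed.

Lemma smooth_cdf_left x : x <= a -> smooth_cdf x = Phi x.
Proof.
move=> xa; apply: eq_Rintegral => t; rewrite inE /= in_itv /= => tx.
by rewrite ramp_left ?mul1r // (le_trans tx).
Qed.

Definition smooth_mass := smooth_cdf b.

Lemma smooth_cdf_right x : b <= x -> smooth_cdf x = smooth_mass.
Proof.
move=> bx; have [z /andP[bz _]] := is_derive_MVT is_derive_smooth_cdf bx.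
by rewrite /dens ramp_right // !mul0r => /eqP; rewrite subr_eq0 => /eqP.
Qed.

Lemma smooth_mass_bounds : Phi a <= smooth_mass <= Phi b.
Proof.
rewrite -(smooth_cdf_left (lexx a)); apply/andP; split.
  apply: (is_derive_ndecr is_derive_smooth_cdf (ltW ab)) => z _.
  by rewrite mulr_ge0 ?ramp_ge0 // ltW ?phi_gt0.
have d (z : R) : is_derive z 1 (Phi - smooth_cdf) (phi z - dens z).
  exact: is_deriveB (is_derive_Phi z) (is_derive_smooth_cdf z).
have := is_derive_ndecr d (ltW ab); rewrite !fctE /= smooth_cdf_left //.
rewrite subrr subr_ge0; apply => z _.
by rewrite subr_ge0 ler_piMl ?ramp_le1 // ltW ?phi_gt0.
Qed.

(** Dividing by the integrating factor [phi] solves [f' - x f = ramp - c] with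
[c = smooth_mass]; subtracting [c * Phi] makes the numerator vanish at both
ends, so that [f] is bounded. *)
Definition stein_f (x : R) := (smooth_cdf x - smooth_mass * Phi x) / phi x.
Definition stein_f' (x : R) := ramp x - smooth_mass + x * stein_f x.

Lemma is_derive_stein_f (x : R) : is_derive x 1 stein_f (stein_f' x).
Proof.
have d1 := is_deriveB (is_derive_smooth_cdf x) (is_deriveZ smooth_mass (is_derive_Phi x)).
have d2 := is_deriveV (phi_neq0 x) (is_derive_phi x).
apply: (is_derive_eq (is_deriveM d1 d2)).
rewrite /stein_f' /stein_f /dens !fctE /GRing.scale /=.
have := phi_neq0 x.
suff: forall h K C P f : R, f != 0 ->
  (K - C * P) * (- f ^- 2 * (- x * f)) + f^-1 * (h * f - C * f) =
  h - C + x * ((K - C * P) / f) by move=> H; apply: H.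
by move=> *; field.
Qed.

Lemma stein_f_left x : x <= a -> stein_f x = (1 - smooth_mass) * (Phi x / phi x).
Proof. by move=> xa; rewrite /stein_f smooth_cdf_left //; ring. Qed.

Lemma stein_f_right x : b <= x -> stein_f x = smooth_mass * (Phi (- x) / phi (- x)).
Proof. by move=> bx; rewrite /stein_f smooth_cdf_right // PhiN phiN; ring. Qed.

(** The third bound, on the derivative of [x * f x], is what makes
[f' = ramp - c + x * f x] Lipschitz. *)
Lemma stein_f_bounded : exists2 B : R, 0 <= B & forall x : R,
  [/\ `|stein_f x| <= B, `|stein_f' x| <= B & `|stein_f x + x * stein_f' x| <= B].
Proof.
have cf : continuous stein_f := is_derive_continuous is_derive_stein_f.
have cf' : continuous stein_f'.
  move=> x; apply: cvgD; last by apply: cvgM; [exact: cvg_id|exact: cf].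
  by apply: cvgB; [exact: ramp_continuous|exact: cvg_cst].
have cg : continuous (fun x => stein_f x + x * stein_f' x).
  by move=> x; apply: cvgD; [exact: cf|apply: cvgM; [exact: cvg_id|exact: cf']].
pose u := Num.min a (-1); pose v := Num.max b 1.
have [B1 _ h1] := continuous_bounded u v cf.
have [B2 _ h2] := continuous_bounded u v cf'.
have [B3 _ h3] := continuous_bounded u v cg.
have c01 : 0 <= smooth_mass <= 1.
  by have /andP[/(le_trans (Phi_ge0 a)) -> /le_trans->] := smooth_mass_bounds;
    rewrite ?Phi_le1.
(* In each tail [f], [f'] and [f + x f'] are, up to sign, a constant in
   [0, 1] times [Phi], [Phi1] and [Phi2] over [phi]; the right tail is reflected
   to the left one. *)
have tail (c y : R) : 0 <= c <= 1 -> y <= -1 ->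
   [/\ `|c * (Phi y / phi y)| <= 1, `|c * (Phi1 y / phi y)| <= 1
     & `|c * (Phi2 y / phi y)| <= 1].
  move=> /andP[c0 c1] y1.
  have aux z : 0 <= z <= phi y -> `|c * (z / phi y)| <= 1.
    move=> /andP[z0 z1].
    have q0 : 0 <= z / phi y by rewrite divr_ge0 // ltW // phi_gt0.
    have m0 : 0 <= c * (z / phi y) by rewrite mulr_ge0.
    rewrite (ger0_norm m0); apply: mulr_ile1 => //.
    by rewrite ler_pdivrMr ?phi_gt0 // mul1r.
  split; apply: aux; apply/andP; split.
  - exact: Phi_ge0.
  - exact: Phi_le_phi.
  - exact: Phi1_ge0.
  - exact: Phi1_le.
  - exact: Phi2_ge0.
  - exact: Phi2_le.
exists (Num.max 1 (Num.max B1 (Num.max B2 B3))) => [|x].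
  by rewrite le_max ler01.
have [xu|ux] := leP x u.
  have [xa x1] : x <= a /\ x <= -1 by move: xu; rewrite le_min => /andP.
  have := @tail (1 - smooth_mass) x.
  case; [lra|done|] => t1 t2 t3.
  have px := phi_neq0 x.
  have e1 : stein_f' x = (1 - smooth_mass) * (Phi1 x / phi x).
    by rewrite /stein_f' ramp_left // stein_f_left // /Phi1; field.
  have e2 : stein_f x + x * stein_f' x = (1 - smooth_mass) * (Phi2 x / phi x).
    by rewrite e1 stein_f_left // /Phi1 /Phi2; field.
  by rewrite e2 e1 stein_f_left // !le_max t1 t2 t3.
have [vx|xv] := leP v x.
  have [bx x1] : b <= x /\ 1 <= x by move: vx; rewrite ge_max => /andP.
  have := @tail smooth_mass (- x).
  case; [lra|lra|] => t1 t2 t3.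
  have px := phi_neq0 (- x).
  have e1 : stein_f' x = - (smooth_mass * (Phi1 (- x) / phi (- x))).
    by rewrite /stein_f' ramp_right // stein_f_right // /Phi1; field.
  have e2 : stein_f x + x * stein_f' x = smooth_mass * (Phi2 (- x) / phi (- x)).
    by rewrite e1 stein_f_right // /Phi1 /Phi2; field.
  by rewrite e2 e1 stein_f_right // normrN !le_max t1 t2 t3.
have xuv : u <= x <= v by rewrite !ltW.
by rewrite !le_max h1 // h2 // h3 // !orbT.
Qed.

(** The constants depend on [a] and [b] in an uncontrolled way, which is harmless
since [a] and [b] are fixed before [N] tends to infinity. *)
Lemma stein_solution : exists (h f f' : R -> R) (c B : R),
  [/\ 0 <= B, Phi a <= c <= Phi b, forall x : R, (x <= a)%R%:R <= h x <= (x <= b)%R%:R,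
      forall x, f' x - x * f x = h x - c
    & forall x y, `|f' x| <= B /\ `|f y - f x - f' x * (y - x)| <= B * (y - x) ^+ 2].
Proof.
have [B0 B00 hB] := stein_f_bounded.
have ba : 0 < (b - a)^-1 by rewrite invr_gt0 subr_gt0.
exists ramp, stein_f, stein_f', smooth_mass, (B0 + (b - a)^-1); split.
- by rewrite addr_ge0 // ltW.
- exact: smooth_mass_bounds.
- exact: ramp_bounds.
- by move=> x; rewrite /stein_f' addrK.
move=> x y; have [_ f'x _] := hB x; split.
  by apply: (le_trans f'x); rewrite lerDl ltW.
have lip z : `|stein_f' z - stein_f' x| <= (B0 + (b - a)^-1) * `|z - x|.
  have d (w : R) : is_derive w 1 (id * stein_f) (stein_f w + w * stein_f' w).
    apply: (is_derive_eq (is_deriveM (is_derive_id w 1) (is_derive_stein_f w))).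
    by rewrite /GRing.scale /= mulr1 addrC.
  have h1 := @is_derive_lipschitz _ _ _ B0 x z d (fun w => let: And3 _ _ h := hB w in h).
  have -> : stein_f' z - stein_f' x = (ramp z - ramp x) + (z * stein_f z - x * stein_f x).
    by rewrite /stein_f'; ring.
  apply: (le_trans (ler_normD _ _)); rewrite mulrDl addrC lerD //.
  exact: ramp_lipschitz.
have mvt : exists2 z, `|z - x| <= `|y - x| & stein_f y - stein_f x = stein_f' z * (y - x).
  have [xy|/ltW yx] := leP x y.
    have [z /andP[xz zy] e] := is_derive_MVT is_derive_stein_f xy.
    by exists z => //; rewrite !ger0_norm ?subr_ge0 ?lerB.
  have [z /andP[yz zx] e] := is_derive_MVT is_derive_stein_f yx.
  exists z; last by rewrite -opprB e -mulrN opprB.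
  by rewrite ![`|_ - x|]distrC !ger0_norm ?subr_ge0 ?lerB.
have [z zx ->] := mvt.
rewrite -mulrBl normrM -real_normK ?num_real // expr2 mulrA ler_wpM2r //.
by apply: (le_trans (lip z)); rewrite ler_wpM2l // addr_ge0 // ltW.
Qed.

End SteinSolution.

(** * Expectation over uniform m-subsets *)

Section PermExpectation.
Variables (R : realType) (N m : nat).
Implicit Types (f g : {set 'I_N} -> R) (X : {set 'I_N}).
Local Notation E := (@perm_E R N m).

Lemma perm_E_eq f g : (forall X, #|X| = m -> f X = g X) -> E f = E g.
Proof. by move=> fg; apply: eq_bigr => X /eqP Xm; rewrite fg. Qed.

Lemma perm_E_sum (I : Type) (s : seq I) (P : pred I) (F : I -> {set 'I_N} -> R) :
  E (fun X => \sum_(i <- s | P i) F i X) = \sum_(i <- s | P i) E (F i).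
Proof.
rewrite /perm_E exchange_big /=; apply: eq_bigr => X _.
by rewrite mulr_sumr.
Qed.

Lemma perm_ED f g : E (fun X => f X + g X) = E f + E g.
Proof. by rewrite /perm_E -big_split; apply: eq_bigr => X _ /=; rewrite mulrDr. Qed.

Lemma perm_EZ c f : E (fun X => c * f X) = c * E f.
Proof. by rewrite /perm_E mulr_sumr; apply: eq_bigr => X _; rewrite mulrCA. Qed.

Lemma perm_EN f : E (fun X => - f X) = - E f.
Proof. by rewrite -mulN1r -perm_EZ; apply: perm_E_eq => X _; rewrite mulN1r. Qed.

Lemma perm_EB f g : E (fun X => f X - g X) = E f - E g.
Proof. by rewrite perm_ED perm_EN. Qed.

Lemma perm_E_le f g : (forall X, #|X| = m -> f X <= g X) -> E f <= E g.
Proof.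
by move=> fg; apply: ler_sum => X /eqP Xm; rewrite ler_wpM2l ?invr_ge0 ?ler0n // fg.
Qed.

Lemma perm_E_ge0 f : (forall X, #|X| = m -> 0 <= f X) -> 0 <= E f.
Proof.
by move=> f0; apply: sumr_ge0 => X /eqP Xm; rewrite mulr_ge0 ?invr_ge0 ?ler0n // f0.
Qed.

Lemma perm_E_norm f : `|E f| <= E (fun X => `|f X|).
Proof.
rewrite ler_norml -perm_EN; apply/andP; split; apply: perm_E_le => X _.
  by rewrite lerNl -normrN ler_norm.
exact: ler_norm.
Qed.

Hypothesis mN : (m <= N)%N.

Lemma perm_E_cst c : E (fun=> c) = c.
Proof.
rewrite /perm_E sumr_const -[X in _ *+ X]cardsE card_draws card_ord.
by rewrite -[LHS]mulr_natr mulrAC mulVf ?mul1r // pnatr_eq0 -lt0n bin_gt0.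
Qed.

(** The variance of [`|f|] is nonnegative. *)
Lemma perm_E_norm_sqr f : E (fun X => `|f X|) ^+ 2 <= E (fun X => f X ^+ 2).
Proof.
set c := E _; rewrite -subr_ge0.
have : 0 <= E (fun X => (`|f X| - c) ^+ 2) by apply: perm_E_ge0 => X _; exact: sqr_ge0.
rewrite (_ : E (fun X => (`|f X| - c) ^+ 2) =
    E (fun X => (f X ^+ 2 + c ^+ 2) - (2 * c) * `|f X|)); last first.
  by apply: perm_E_eq => X _; rewrite -[f X ^+ 2]real_normK ?num_real //; ring.
rewrite perm_EB perm_ED perm_E_cst perm_EZ -/c => h.
by apply: le_trans h _; rewrite le_eqVlt; apply/orP; left; apply/eqP; ring.
Qed.

Lemma perm_E_norm_le f K : E (fun X => f X ^+ 2) <= K ->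
  E (fun X => `|f X|) <= Num.sqrt K.
Proof.
move=> h; have E0 : 0 <= E (fun X => `|f X|) by exact: perm_E_ge0.
rewrite -(ger0_norm E0) -sqrtr_sqr ler_wsqrtr //.
exact: le_trans (perm_E_norm_sqr f) h.
Qed.

Definition swap (i j : 'I_N) X : {set 'I_N} := [set k | tperm i j k \in X]%SET.

Lemma in_swap i j k X : (k \in swap i j X) = (tperm i j k \in X).
Proof. by rewrite inE. Qed.

Lemma swapK i j : involutive (swap i j).
Proof. by move=> X; apply/setP => k; rewrite !inE tpermK. Qed.

Lemma card_swap i j X : #|swap i j X| = #|X|.
Proof.
have -> : swap i j X = (tperm i j @^-1: X)%SET by apply/setP => k; rewrite !inE.
by rewrite card_preimset //; exact: perm_inj.
Qed.

Lemma perm_E_swap i j f : E (fun X => f (swap i j X)) = E f.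
Proof.
rewrite /perm_E [RHS](reindex_inj (inv_inj (swapK i j))).
by apply: eq_bigl => X; rewrite card_swap.
Qed.

End PermExpectation.

(** * Second moments of multilinear polynomials in the centred labels *)

Section Moments.
Variables (R : realType) (N m n : nat).
Hypothesis hmn : (m + n)%N = N.
Hypothesis N12 : (12 <= N)%N.
Local Notation E := (@perm_E R N m).
Implicit Types (X S T A B : {set 'I_N}).

Definition prob1 : R := m%:R / N%:R.
(** The centred labels. *)
Definition ctr X (i : 'I_N) : R := (i \in X)%:R - prob1.
Local Notation p := prob1.
Local Notation q := (1 - p).
Local Notation v := (p * q).

Let mN : (m <= N)%N. Proof. by rewrite -hmn leq_addr. Qed.
Let N0 : N%:R != 0 :> R. Proof. by rewrite pnatr_eq0 -lt0n (leq_trans _ N12). Qed.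

Lemma prob1_ge0 : 0 <= p. Proof. by rewrite divr_ge0. Qed.
Lemma prob1_le1 : p <= 1.
Proof.
have h : 0 < N%:R :> R by rewrite ltr0n (leq_trans _ N12).
by rewrite /prob1 ler_pdivrMr // mul1r ler_nat.
Qed.

Lemma probC : q = n%:R / N%:R.
Proof.
have -> : n%:R = N%:R - m%:R :> R by rewrite -hmn natrD addrAC subrr add0r.
by rewrite mulrBl divff.
Qed.

Lemma ctr_sum X : #|X| = m -> \sum_i ctr X i = 0.
Proof.
move=> Xm; rewrite sumrB sumr_const card_ord -[X in _ - X]mulr_natr divfK //.
by rewrite -Xm -sum1_card natr_sum [X in _ - X]big_mkcond -sumrB big1 // => i _ /=; case: ifP; rewrite subrr.
Qed.

Lemma ctr_sqr X i : ctr X i ^+ 2 = v + (q - p) * ctr X i.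
Proof. by rewrite /ctr; case: (i \in X); rewrite ?mulr1n ?mulr0n; ring. Qed.

Lemma ctr_norm X i : `|ctr X i| <= 1.
Proof.
have := prob1_ge0; have := prob1_le1; rewrite /ctr ler_norml.
by case: (i \in X) => /= ? ?; apply/andP; split; lra.
Qed.

Lemma ctr_swap i j X k : ctr (swap i j X) k = ctr X (tperm i j k).
Proof. by rewrite /ctr in_swap. Qed.

Definition xprod A X : R := \prod_(i in A) ctr X i.

Lemma xprod_set0 X : xprod finset.set0 X = 1.
Proof. by rewrite /xprod big_set0. Qed.

Lemma xprodU1 i A X : i \notin A -> xprod (i |: A)%SET X = ctr X i * xprod A X.
Proof. by move=> iA; rewrite /xprod big_setU1. Qed.

Lemma xprodD1 i A X : i \in A -> xprod A X = ctr X i * xprod (A :\ i)%SET X.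
Proof. by move=> iA; rewrite /xprod (big_setD1 i). Qed.

Lemma xprod_swap i j A X : i \notin A -> j \notin A -> xprod A (swap i j X) = xprod A X.
Proof.
move=> iA jA; apply: eq_bigr => k kA; rewrite ctr_swap tpermD //.
  by apply: contraNneq iA => ->.
by apply: contraNneq jA => ->.
Qed.

(** Multiply [sum_j x_j = 0] by the product over [A] and take expectations.  The
terms with [j] outside [A] are all equal by exchangeability; in the others the
square [x_j ^+ 2] is an affine function of [x_j]. *)
Lemma moment_rec i A : i \notin A ->
  (N - #|A|)%:R * E (xprod (i |: A)%SET) =
  - \sum_(j in A) (v * E (xprod (A :\ j)%SET) + (q - p) * E (xprod A)).
Proof.
move=> iA.
have e1 : \sum_j E (fun X => ctr X j * xprod A X) = 0.
  rewrite -perm_E_sum -[RHS](@perm_E_cst R N m mN); apply: perm_E_eq => X Xm.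
  by rewrite -mulr_suml ctr_sum // mul0r.
have e2 j : j \notin A -> E (fun X => ctr X j * xprod A X) = E (xprod (i |: A)%SET).
  move=> jA; rewrite -(perm_E_swap m i j); apply: perm_E_eq => X _.
  by rewrite xprod_swap // ctr_swap tpermR xprodU1.
have e3 j : j \in A -> E (fun X => ctr X j * xprod A X) =
    v * E (xprod (A :\ j)%SET) + (q - p) * E (xprod A).
  move=> jA; rewrite -!perm_EZ -perm_ED; apply: perm_E_eq => X _.
  rewrite (xprodD1 _ jA) mulrA -expr2 ctr_sqr; ring.
move: e1; rewrite (bigID (mem A)) /= (eq_bigr _ e3) [X in _ + X](eq_bigr _ e2).
have cE : #|[predC A]| = (N - #|A|)%N by have := cardC A; rewrite card_ord; lia.
rewrite sumr_const (_ : #|_| = N - #|A|)%N; last by rewrite -cE; apply: eq_card.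
by move=> h; rewrite mulr_natl; apply/eqP; rewrite -addr_eq0 addrC; apply/eqP.
Qed.

(** The order of magnitude of the covariance of two labels.  The factor 12
absorbs the constants of the recursion for products of at most 6 factors. *)
Definition eps : R := 12 / N%:R.
Lemma eps_gt0 : 0 < eps. Proof. by rewrite divr_gt0 // ltr0n (leq_trans _ N12). Qed.
Lemma eps_le1 : eps <= 1.
Proof.
have h : 0 < N%:R :> R by rewrite ltr0n (leq_trans _ N12).
by rewrite /eps ler_pdivrMr // mul1r ler_nat.
Qed.

Lemma eps_exp_le k l : (k <= l)%N -> eps ^+ l <= eps ^+ k.
Proof. by move=> kl; apply: ler_wiXn2l => //; [exact: ltW eps_gt0|exact: eps_le1]. Qed.

Lemma var_skew_le1 : v + `|q - p| <= 1.
Proof.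
have p0 := prob1_ge0; have p1 := prob1_le1.
have [h|h] := ler0P (q - p); [have := mulr_ge0 p0 p0|have := mulr_ge0 p0 p0]; nra.
Qed.

Lemma var_ge0 : 0 <= v.
Proof. by rewrite mulr_ge0 ?prob1_ge0 // subr_ge0 prob1_le1. Qed.

(** One step of the recursion removes at most two factors and gains a factor of
order [1/N]. *)
Lemma moment_bound A : (#|A| <= 6)%N -> `|E (xprod A)| <= eps ^+ uphalf #|A|.
Proof.
have [k] := ubnP #|A|; elim: k A => // k IH A; rewrite ltnS => Ak A6.
have [->|[i iA]] := set_0Vmem A.
  rewrite cards0 expr0 -[leRHS]normr1 -(@perm_E_cst R N m mN 1).
  rewrite le_eqVlt; apply/orP; left; apply/eqP; congr `|_|; apply: perm_E_eq => X _.
  exact: xprod_set0.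
have iB : i \notin (A :\ i)%SET by rewrite !inE eqxx.
have cB : #|A| = #|(A :\ i)%SET|.+1 by rewrite (cardsD1 i) iA.
set B := (A :\ i)%SET in iB cB.
have -> : A = (i |: B)%SET by rewrite finset.setD1K.
have cA : #|(i |: B)%SET| = #|B|.+1 by rewrite cardsU1 iB.
rewrite cA.
have NB : 0 < (N - #|B|)%:R :> R by rewrite ltr0n subn_gt0; lia.
rewrite -(ler_pM2l NB) -[X in X * `|_|]ger0_norm ?ler0n // -normrM moment_rec // normrN.
apply: (le_trans (ler_norm_sum _ _ _)).
apply: (@le_trans _ _ (\sum_(j in B) eps ^+ (uphalf #|B|.-1))).
  apply: ler_sum => j jB.
  have cj : #|B| = #|(B :\ j)%SET|.+1 by rewrite (cardsD1 j) jB.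
  have h1 : `|E (xprod (B :\ j)%SET)| <= eps ^+ uphalf #|B|.-1.
    by rewrite [in leRHS]cj /=; apply: IH; lia.
  have h2 : `|E (xprod B)| <= eps ^+ uphalf #|B|.-1.
    apply: (@le_trans _ _ (eps ^+ uphalf #|B|)); first by apply: IH; lia.
    by apply: eps_exp_le; lia.
  apply: (le_trans (ler_normD _ _)); rewrite (normrM v) (normrM (q - p)) (ger0_norm var_ge0).
  have h3 : v * `|E (xprod (B :\ j)%SET)| <= v * eps ^+ uphalf #|B|.-1.
    by rewrite ler_wpM2l // var_ge0.
  have h4 : `|q - p| * `|E (xprod B)| <= `|q - p| * eps ^+ uphalf #|B|.-1.
    by rewrite ler_wpM2l.
  apply: (le_trans (lerD h3 h4)); rewrite -mulrDl ler_piMl ?var_skew_le1 //.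
  by rewrite exprn_ge0 // ltW // eps_gt0.
rewrite sumr_const -[leLHS]mulr_natl.
have [B0|B0] := posnP #|B|.
  by rewrite B0 mul0r mulr_ge0 // exprn_ge0 // ltW // eps_gt0.
have -> : uphalf #|B|.+1 = (uphalf #|B|.-1).+1 by lia.
rewrite exprS mulrA ler_wpM2r //; first by rewrite exprn_ge0 // ltW // eps_gt0.
rewrite mulrA ler_pdivlMr ?ltr0n; last by lia.
by rewrite -!natrM ler_nat; nia.
Qed.

(** Squared factors are harmless: replacing [x_j ^+ 2] by [v + (q - p) x_j] only
produces products with at least as many singletons, with coefficients whose
absolute values have sum at most 1. *)
Lemma moment_bound2 A B : [disjoint A & B] -> (#|A| + #|B| <= 6)%N ->
  `|E (fun X => xprod A X * \prod_(i in B) ctr X i ^+ 2)| <= eps ^+ uphalf #|A|.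
Proof.
have [k] := ubnP #|B|; elim: k A B => // k IH A B; rewrite ltnS => Bk dAB AB6.
have [B0|[j jB]] := set_0Vmem B.
  rewrite (_ : E _ = E (xprod A)); last first.
    by apply: perm_E_eq => X _; rewrite B0 big_set0 mulr1.
  by apply: moment_bound; lia.
have cB : #|B| = #|(B :\ j)%SET|.+1 by rewrite (cardsD1 j) jB.
have jA : j \notin A by rewrite (disjointFl dAB).
have d1 : [disjoint A & (B :\ j)%SET].
  by apply: disjointWr dAB; exact: subD1set.
have d2 : [disjoint (j |: A)%SET & (B :\ j)%SET].
  apply/pred0P => l; have /pred0P/(_ l) := d1; rewrite /= !inE.
  by case: (l == j); case: (l \in A).
have -> : E (fun X => xprod A X * \prod_(i in B) ctr X i ^+ 2) =
   v * E (fun X => xprod A X * \prod_(i in (B :\ j)%SET) ctr X i ^+ 2) +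
   (q - p) * E (fun X => xprod (j |: A)%SET X * \prod_(i in (B :\ j)%SET) ctr X i ^+ 2).
  rewrite -!perm_EZ -perm_ED; apply: perm_E_eq => X _.
  rewrite (big_setD1 j) //= ctr_sqr xprodU1 //; ring.
have cjA : #|(j |: A)%SET| = #|A|.+1 by rewrite cardsU1 jA.
have h1 : `|E (fun X => xprod A X * \prod_(i in (B :\ j)%SET) ctr X i ^+ 2)| <=
    eps ^+ uphalf #|A|.
  by apply: IH => //; clear -cB Bk AB6; lia.
have h2 : `|E (fun X => xprod (j |: A)%SET X * \prod_(i in (B :\ j)%SET) ctr X i ^+ 2)| <=
    eps ^+ uphalf #|A|.
  apply: (@le_trans _ _ (eps ^+ uphalf #|(j |: A)%SET|)).
    by apply: IH => //; rewrite ?cjA; clear -cB Bk AB6; lia.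
  by apply: eps_exp_le; rewrite cjA; clear; lia.
apply: (le_trans (ler_normD _ _)); rewrite (normrM v) (normrM (q - p)) (ger0_norm var_ge0).
apply: (le_trans (lerD (ler_wpM2l var_ge0 h1) (ler_wpM2l (normr_ge0 _) h2))).
rewrite -mulrDl ler_piMl ?var_skew_le1 //.
by rewrite exprn_ge0 // ltW // eps_gt0.
Qed.

(** In the product the factors over [S] and [T] are squared on the intersection
and simple on the symmetric difference, which has [2 * #|T :\: S|] elements. *)
Lemma gram_bound S T : #|S| = #|T| -> (#|S| <= 3)%N ->
  `|E (fun X => xprod S X * xprod T X)| <= eps ^+ #|T :\: S|%SET.
Proof.
move=> ST S3; pose A := ((S :\: T) :|: (T :\: S))%SET.
have dA : [disjoint A & (S :&: T)%SET].
  by rewrite -setI_eq0; apply/eqP/setP => k; rewrite !inE; do !case: (_ \in _).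
have c1 : (#|S :\: T| = #|T :\: S|)%SET by rewrite !cardsD ST finset.setIC.
have cA : #|A| = (#|T :\: S|.*2)%SET.
  rewrite cardsU (_ : _ :&: _ = finset.set0)%SET ?cards0 ?subn0 ?c1 ?addnn //.
  by apply/setP => k; rewrite !inE; do !case: (_ \in _).
have cI : (#|S :&: T| + #|S :\: T| = #|S|)%N by rewrite cardsID.
have := moment_bound2 dA; rewrite cA uphalf_double => /(_ ltac:(lia)).
congr (`|_| <= _); apply: perm_E_eq => X _.
rewrite /xprod !(big_mkcond (fun i => i \in _)) -!big_split /=.
apply: eq_bigr => i _; rewrite !inE.
by case: (i \in S); case: (i \in T); rewrite /= ?mulr1 ?mul1r.
Qed.

Section Schur.
Variables (J : finType) (sg : J -> {set 'I_N}) (d : nat) (K : R).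
Hypothesis d3 : (d <= 3)%N.
Hypothesis sK : forall s, #|sg s| = d ->
  \sum_(t | #|sg t| == d) eps ^+ #|sg t :\: sg s|%SET <= K.

(** Schur test for the Gram matrix of the monomials: by symmetry of the weights
[eps ^+ #|sg t :\: sg s|] its operator norm is at most the largest row sum.
In the uses below the row sums stay bounded because at most of order [N ^ k]
index sets differ from a given one in [k] elements. *)
Lemma slice_schur (c : J -> R) : (forall s, #|sg s| <> d -> c s = 0) ->
  E (fun X => (\sum_s c s * xprod (sg s) X) ^+ 2) <= K * \sum_s c s ^+ 2.
Proof.
move=> c0.
have e1 : E (fun X => (\sum_s c s * xprod (sg s) X) ^+ 2) =
   \sum_s \sum_t c s * c t * E (fun X => xprod (sg s) X * xprod (sg t) X).
  under [RHS]eq_bigr do under eq_bigr do rewrite -perm_EZ.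
  under [RHS]eq_bigr do rewrite -perm_E_sum.
  rewrite -perm_E_sum; apply: perm_E_eq => X _.
  rewrite expr2 mulr_suml; apply: eq_bigr => s _.
  by rewrite mulr_sumr; apply: eq_bigr => t _; ring.
pose w s t := eps ^+ #|sg t :\: sg s|%SET.
have restr (F : J -> R) : (forall s, #|sg s| <> d -> F s = 0) ->
    \sum_s F s = \sum_(s | #|sg s| == d) F s.
  move=> F0; rewrite [RHS]big_mkcond /=; apply: eq_bigr => s _.
  by case: eqP => // /F0.
rewrite e1 restr; last first.
  by move=> s /c0 ->; rewrite big1 // => t _; rewrite !mul0r.
under eq_bigr => s _.
  rewrite restr; last by move=> t /c0 ->; rewrite mulr0 mul0r.
  over.
apply: (@le_trans _ _ (\sum_(s | #|sg s| == d) \sum_(t | #|sg t| == d)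
    (c s ^+ 2 / 2 * w s t + c t ^+ 2 / 2 * w s t))).
  apply: ler_sum => s /eqP sd; apply: ler_sum => t /eqP td.
  apply: (le_trans (ler_norm _)); rewrite normrM -mulrDl.
  apply: ler_pM => //.
    rewrite normrM -[c s ^+ 2]real_normK ?num_real // -[c t ^+ 2]real_normK ?num_real //.
    have := sqr_ge0 (`|c s| - `|c t|); nra.
  by apply: gram_bound; rewrite ?sd ?td.
under eq_bigr do rewrite big_split.
rewrite big_split /= [X in _ + X]exchange_big /=.
have -> : \sum_(j | #|sg j| == d) \sum_(i | #|sg i| == d) c j ^+ 2 / 2 * w i j =
   \sum_(i | #|sg i| == d) \sum_(j | #|sg j| == d) c i ^+ 2 / 2 * w i j.
  apply: eq_bigr => j /eqP jd; apply: eq_bigr => i /eqP ii.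
  by rewrite /w !cardsD ii jd finset.setIC.
rewrite -[leLHS]mulr2n -[leLHS]mulr_natl.
rewrite [X in _ <= _ * X]restr; last by move=> s /c0 ->; rewrite expr0n.
rewrite !mulr_sumr; apply: ler_sum => s /eqP sd; rewrite -mulr_sumr mulrA.
have -> : 2 * (c s ^+ 2 / 2) = c s ^+ 2 by field.
by rewrite mulrC ler_wpM2r ?sqr_ge0 // sK.
Qed.

End Schur.

(** The weight [eps ^+ #|T :\: S|] is multiplicative over the elements of [T], so
that row sums over tuples are powers of the sum of [w S]. *)
Let w S k : R := if k \in S then 1 else eps.

Let w_ge0 S k : 0 <= w S k.
Proof. by rewrite /w; case: ifP => // _; rewrite ltW // eps_gt0. Qed.

Let w_sum S : (#|S| <= 3)%N -> \sum_k w S k <= 15.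
Proof.
move=> S3; rewrite (bigID (mem S)) /=.
rewrite (eq_bigr (fun=> 1)) => [|k kS]; last by rewrite /w kS.
rewrite [X in _ + X](eq_bigr (fun=> eps)) => [|k kS]; last by rewrite /w (negbTE kS).
rewrite !sumr_const -[(eps *+ _)%R]mulr_natl.
have h1 : #|S|%:R <= 3 :> R by rewrite (ler_nat _ _ 3).
have h2 : #|[predC S]|%:R * eps <= 12.
  rewrite mulrA ler_pdivrMr ?ltr0n ?(leq_trans _ N12) // mulrC ler_pM2l //.
  by rewrite ler_nat -[leqRHS]card_ord max_card.
by have := lerD h1 h2; move=> h; apply: le_trans h _; lra.
Qed.

Let eps_prod S T : eps ^+ #|T :\: S|%SET = \prod_(k in T) w S k.
Proof.
rewrite (big_setID S) /= big1 ?mul1r => [|k]; last by rewrite inE /w => /andP[_ ->].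
rewrite (eq_bigr (fun=> eps)) ?prodr_const // => k.
by rewrite inE /w => /andP[/negbTE ->].
Qed.

(** [15 = 3 + 12] bounds the total weight of all nodes, with at most 3 nodes of
weight 1 and the others of weight [12 / N]; the power is the largest degree
considered. *)
Definition slice_const : R := 15 ^+ 3.

Lemma slice_linear (c : 'I_N -> R) :
  E (fun X => (\sum_i c i * ctr X i) ^+ 2) <= slice_const * \sum_i c i ^+ 2.
Proof.
rewrite (_ : E _ = E (fun X => (\sum_i c i * xprod [set i]%SET X) ^+ 2)); last first.
  by apply: perm_E_eq => X _; congr (_ ^+ 2); apply: eq_bigr => i _; rewrite /xprod big_set1.
apply: (@slice_schur _ _ 1) => // [s _|s]; last by rewrite cards1.
apply: (@le_trans _ _ 15); last by rewrite /slice_const; lra.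
apply: le_trans (w_sum (_ : (#|[set s]%SET| <= 3)%N)); last by rewrite cards1.
rewrite [leLHS]big_mkcond; apply: ler_sum => t _.
by rewrite cards1 eqxx eps_prod big_set1.
Qed.

Lemma slice_quadratic (c : 'I_N -> 'I_N -> R) : (forall i, c i i = 0) ->
  E (fun X => (\sum_i \sum_j c i j * (ctr X i * ctr X j)) ^+ 2) <=
  slice_const * \sum_i \sum_j c i j ^+ 2.
Proof.
move=> c0; pose sg (s : 'I_N * 'I_N) := [set s.1; s.2]%SET.
have card2 s : #|sg s| = 2 -> s.1 != s.2.
  by rewrite cards2; case: eqP.
rewrite (pair_bigA _ (fun i j => c i j ^+ 2)) /=.
rewrite (_ : E _ = E (fun X => (\sum_s c s.1 s.2 * xprod (sg s) X) ^+ 2)); last first.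
  apply: perm_E_eq => X _; congr (_ ^+ 2).
  rewrite (pair_bigA _ (fun i j => c i j * (ctr X i * ctr X j))) /=.
  apply: eq_bigr => -[i j] _ /=; have [->|ij] := eqVneq i j; first by rewrite c0 !mul0r.
  by rewrite /sg /xprod big_setU1 ?inE // big_set1.
apply: (@slice_schur _ sg 2) => // [s sd|s]; last first.
  by rewrite cards2; case: eqP => // ->.
apply: (@le_trans _ _ (15 ^+ 2)); last by rewrite /slice_const; lra.
have s3 : (#|sg s| <= 3)%N by rewrite sd.
apply: (@le_trans _ _ ((\sum_k w (sg s) k) ^+ 2)); last first.
  by rewrite ler_pXn2r ?nnegrE ?sumr_ge0 // w_sum.
rewrite expr2 big_distrlr /= (pair_bigA _ (fun i j => w (sg s) i * w (sg s) j)) /=.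
rewrite [leLHS]big_mkcond; apply: ler_sum => t _.
case: ifP => [/eqP/card2 td|_]; last by rewrite mulr_ge0.
by rewrite eps_prod big_setU1 ?inE // big_set1.
Qed.

Lemma slice_cubic (c : 'I_N -> 'I_N -> 'I_N -> R) :
  (forall i j k, c i j k != 0 -> [&& i != j, i != k & j != k]) ->
  E (fun X => (\sum_i \sum_j \sum_k c i j k * (ctr X i * ctr X j * ctr X k)) ^+ 2) <=
  slice_const * \sum_i \sum_j \sum_k c i j k ^+ 2.
Proof.
move=> c0; pose sg (s : 'I_N * ('I_N * 'I_N)) := (s.1 |: [set s.2.1; s.2.2])%SET.
have card3 s : #|sg s| = 3 <-> [&& s.1 != s.2.1, s.1 != s.2.2 & s.2.1 != s.2.2].
  rewrite cardsU1 cards2 !inE negb_or.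
  by case: (s.1 =P _) => _; case: (s.1 =P _) => _; case: (s.2.1 =P _) => _.
have pairE (F : 'I_N -> 'I_N -> 'I_N -> R) :
    \sum_i \sum_j \sum_k F i j k = \sum_s F s.1 s.2.1 s.2.2.
  under eq_bigr => i _ do rewrite (pair_bigA _ (fun j k => F i j k)) /=.
  by rewrite (pair_bigA _ (fun i s => F i s.1 s.2)).
have prod3 (F : 'I_N -> R) s : #|sg s| = 3 ->
    \prod_(k in sg s) F k = F s.1 * F s.2.1 * F s.2.2.
  move=> /card3 /and3P[h1 h2 h3].
  by rewrite big_setU1 ?inE ?negb_or ?h1 //= big_setU1 ?inE // big_set1 mulrA.
rewrite pairE.
rewrite (_ : E _ = E (fun X => (\sum_s c s.1 s.2.1 s.2.2 * xprod (sg s) X) ^+ 2)); last first.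
  apply: perm_E_eq => X _; congr (_ ^+ 2); rewrite pairE; apply: eq_bigr => s _.
  have [->|/c0 /card3 h] := eqVneq (c s.1 s.2.1 s.2.2) 0; first by rewrite !mul0r.
  by rewrite /xprod prod3.
apply: (@slice_schur _ sg 3) => // [s sd|s h]; last first.
  by apply/eqP; apply: contra_notT h => /c0 /card3.
have s3 : (#|sg s| <= 3)%N by rewrite sd.
apply: (@le_trans _ _ ((\sum_k w (sg s) k) ^+ 3)); last first.
  rewrite /slice_const.
  by rewrite ler_pXn2r ?nnegrE ?sumr_ge0 // w_sum.
have -> : (\sum_k w (sg s) k) ^+ 3 =
    \sum_i \sum_j \sum_k w (sg s) i * w (sg s) j * w (sg s) k.
  rewrite !exprS expr0 mulr1 mulr_suml; apply: eq_bigr => i _.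
  rewrite mulr_suml mulr_sumr; apply: eq_bigr => j _.
  by rewrite mulrA mulr_sumr.
rewrite pairE [leLHS]big_mkcond; apply: ler_sum => t _.
case: ifP => [/eqP td|_]; last by rewrite !mulr_ge0.
by rewrite eps_prod prod3.
Qed.

End Moments.

(** * Quadratic forms under the exchange of two labels *)

Section QuadraticForm.
Variables (R : realFieldType) (N : nat) (a : 'I_N -> 'I_N -> R).
Hypothesis a_sym : forall i j, a i j = a j i.
Hypothesis a_irr : forall i, a i i = 0.
Hypothesis a_idem : forall i j, a i j * a i j = a i j.
Implicit Types x : 'I_N -> R.

(** For an adjacency matrix [a], [rowsum x i] is the sum of [x] over the
neighbours of [i], [qform x] is the sum of [x i * x j] over the edges, and
[nedges] is the number of edges. *)
Definition rowsum x i := \sum_j a i j * x j.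
Definition degree i := rowsum (fun=> 1) i.
Definition qform x := 2^-1 * \sum_i x i * rowsum x i.
Definition lform x := \sum_i degree i * x i.
Definition nedges := 2^-1 * \sum_i degree i.

Lemma sum_delta (f : 'I_N -> R) l : \sum_k (k == l)%:R * f k = f l.
Proof.
rewrite (bigD1 l) //= eqxx mul1r big1 ?addr0 // => k /negbTE ->; exact: mul0r.
Qed.

Lemma sum_degree : \sum_i degree i = 2 * nedges.
Proof. by rewrite /nedges; field. Qed.

Lemma sum_rowsum x : \sum_i rowsum x i = lform x.
Proof.
rewrite exchange_big; apply: eq_bigr => j _; rewrite mulr_suml.
by apply: eq_bigr => i _; rewrite a_sym mulr1.
Qed.

Lemma sum_x_rowsum x : \sum_i x i * rowsum x i = 2 * qform x.
Proof. by rewrite /qform; field. Qed.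

Lemma sum_dprod (f g : 'I_N -> R) : \sum_i \sum_j f i * g j = (\sum_i f i) * (\sum_j g j).
Proof. by rewrite big_distrlr. Qed.

Lemma sum_one_l (g : 'I_N -> R) : \sum_(i < N) \sum_j g j = N%:R * \sum_j g j.
Proof. by rewrite sumr_const card_ord -[LHS]mulr_natl. Qed.

Lemma sum_one_r (f : 'I_N -> R) : \sum_i \sum_(j < N) f i = N%:R * \sum_i f i.
Proof. by rewrite exchange_big sum_one_l. Qed.

(** With [u = x j - x i] the perturbed vector is [x] with its entries [i] and [j]
exchanged. *)
Lemma qform_perturb x i j u :
  let x' k := x k + u * ((k == i)%:R - (k == j)%:R) in
  qform x' = qform x + u * (rowsum x i - rowsum x j) - a i j * u ^+ 2.
Proof.
move=> x'.
have rs k : rowsum x' k = rowsum x k + u * (a k i - a k j).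
  rewrite /rowsum /x' -(sum_delta (a k) i) -(sum_delta (a k) j) -sumrB mulr_sumr -big_split /=.
  by apply: eq_bigr => l _; ring.
rewrite /qform; under eq_bigr do rewrite rs.
have -> : \sum_k x' k * (rowsum x k + u * (a k i - a k j)) =
   \sum_k x k * rowsum x k + u * (\sum_k (k == i)%:R * rowsum x k) -
   u * (\sum_k (k == j)%:R * rowsum x k) + u * (\sum_k a i k * x k) - u * (\sum_k a j k * x k)
   + u ^+ 2 * (\sum_k (k == i)%:R * a k i) - u ^+ 2 * (\sum_k (k == i)%:R * a k j)
   - u ^+ 2 * (\sum_k (k == j)%:R * a k i) + u ^+ 2 * (\sum_k (k == j)%:R * a k j).
  rewrite !mulr_sumr -!sumrN -!big_split /=; apply: eq_bigr => k _.
  by rewrite /x' (a_sym i k) (a_sym j k); ring.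
by rewrite !sum_delta !a_irr (a_sym j i) -!/(rowsum x _); field.
Qed.

Lemma lform_perturb x i j u :
  let x' k := x k + u * ((k == i)%:R - (k == j)%:R) in
  lform x' = lform x + u * (degree i - degree j).
Proof.
move=> x'.
rewrite -(sum_delta degree i) -(sum_delta degree j) -sumrB mulr_sumr -big_split /=.
by apply: eq_bigr => l _; rewrite /x'; ring.
Qed.

Variables (x : 'I_N -> R) (v s ka : R).
Hypothesis x_sum : \sum_i x i = 0.
Hypothesis x_sqr : forall i, x i ^+ 2 = v + s * x i.
Hypothesis kaE : ka * (N%:R - 2) = s.
Hypothesis N1 : N%:R - 1 != 0 :> R.

Local Notation T := (rowsum x).
Local Notation d := degree.
Local Notation Q := (qform x).
Local Notation L := (lform x).
Local Notation g := nedges.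
Local Notation y := (fun i => T i + ka * d i).

(** The centred weighted edge count in terms of the centred labels; the linear
term is what makes it an eigenfunction in [sum_form_incr]. *)
Definition form_stat := Q + ka * L + v * g / (N%:R - 1).
(** The change of [form_stat] when the entries [i] and [j] of [x] are exchanged. *)
Definition form_incr i j :=
  (x j - x i) * (y i - y j) - a i j * (x j - x i) ^+ 2.

(** The edge term of [form_incr] contributes a multiple of [s L] through [x i ^+ 2]; the
choice [ka * (N - 2) = s] of the coefficient of [lform] compensates it. *)
Lemma sum_form_incr : \sum_i \sum_j form_incr i j = - (4 * (N%:R - 1)) * form_stat.
Proof.
have -> : \sum_i \sum_j form_incr i j =
    \sum_i \sum_j y i * x j + \sum_i \sum_(j < N) (- (x i * y i))
  + \sum_(i < N) \sum_j (- (x j * y j)) + \sum_i \sum_j x i * y j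
  + \sum_i \sum_j a i j * (- v - s * x i) + \sum_i \sum_j a i j * (- v - s * x j)
  + \sum_i \sum_j 2 * (x i * (a i j * x j)).
  rewrite -!big_split /=; apply: eq_bigr => i _; rewrite -!big_split /=.
  apply: eq_bigr => j _; have h1 := x_sqr i; have h2 := x_sqr j.
  have -> : - v - s * x i = - x i ^+ 2 by rewrite h1; ring.
  have -> : - v - s * x j = - x j ^+ 2 by rewrite h2; ring.
  by rewrite /form_incr; ring.
rewrite !sum_dprod x_sum sum_one_r sum_one_l.
have e1 : \sum_i - (x i * y i) = - (2 * Q + ka * L).
  rewrite -sum_x_rowsum mulr_sumr -big_split -sumrN; apply: eq_bigr => i _ /=; ring.
have deg1 i : d i = \sum_j a i j by apply: eq_bigr => j _; rewrite mulr1.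
have e3 : \sum_i \sum_j a i j * (- v - s * x i) = - v * (2 * g) - s * L.
  rewrite -sum_degree !mulr_sumr -sumrN -big_split; apply: eq_bigr => i _ /=.
  by rewrite -mulr_suml -deg1; ring.
have e4 : \sum_i \sum_j a i j * (- v - s * x j) = - v * (2 * g) - s * L.
  rewrite -e3 exchange_big /=; apply: eq_bigr => i _; apply: eq_bigr => j _.
  by rewrite a_sym.
have e5 : \sum_i \sum_j 2 * (x i * (a i j * x j)) = 4 * Q.
  rewrite (_ : 4 * Q = 2 * (2 * Q)); last by ring.
  rewrite -sum_x_rowsum mulr_sumr; apply: eq_bigr => i _.
  by rewrite -!mulr_sumr.
by rewrite e1 e3 e4 e5 /form_stat -kaE; field.
Qed.

(** The part of [rowsum x i ^+ 2] without repeated variables. *)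
Definition offdiag i := \sum_j \sum_k (if j == k then 0 else a i j * a i k * (x j * x k)).

Lemma rowsum_sqr i : T i ^+ 2 = v * d i + s * T i + offdiag i.
Proof.
rewrite /offdiag.
have -> : T i ^+ 2 = \sum_j \sum_k a i j * a i k * (x j * x k).
  by rewrite expr2 -sum_dprod; apply: eq_bigr => j _; apply: eq_bigr => k _; ring.
have -> : v * d i + s * T i = \sum_j \sum_k (if j == k then a i j * a i k * (x j * x k) else 0).
  rewrite /degree /rowsum !mulr_sumr -big_split /=; apply: eq_bigr => j _.
  rewrite -big_mkcond /= (big_pred1 j) => [|k]; last by rewrite eq_sym.
  rewrite a_idem -expr2 x_sqr; ring.
rewrite -big_split /=; apply: eq_bigr => j _; rewrite -big_split /=.
by apply: eq_bigr => k _; case: eqP => _; rewrite ?addr0 ?add0r.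
Qed.

Lemma sum_rowsum_sqr : \sum_i T i ^+ 2 * (2 * v + s * x i) =
  4 * v ^+ 2 * g + 3 * v * s * L + 2 * s ^+ 2 * Q + 2 * v * \sum_i offdiag i
  + s * \sum_i x i * offdiag i.
Proof.
have -> : 4 * v ^+ 2 * g + 3 * v * s * L + 2 * s ^+ 2 * Q =
  2 * v ^+ 2 * (2 * g) + 2 * v * s * L + v * s * L + s ^+ 2 * (2 * Q) by ring.
rewrite -sum_degree -[X in 2 * v * s * X]sum_rowsum -sum_x_rowsum !mulr_sumr -!big_split /=.
by apply: eq_bigr => i _; rewrite rowsum_sqr; ring.
Qed.

(** The double sum factorises because [(x j - x i) ^+ 2] is a sum of products of
functions of [i] and of [j], and terms with a bare [x j] vanish with the sum of
[x]. *)
Lemma sum_form_incr_sqr : \sum_i \sum_j form_incr i j ^+ 2 =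
  2 * N%:R * (\sum_i y i ^+ 2 * (2 * v + s * x i))
  - 4 * v * (\sum_i y i) ^+ 2 - 4 * s * (\sum_i x i * y i) * (\sum_i y i)
  + 4 * (\sum_i x i * y i) ^+ 2
  - 2 * (\sum_i \sum_j a i j * ((x j - x i) ^+ 3 * (y i - y j)))
  + \sum_i \sum_j a i j * (x j - x i) ^+ 4.
Proof.
have -> : \sum_i \sum_j form_incr i j ^+ 2 =
    \sum_i \sum_(j < N) y i ^+ 2 * (2 * v + s * x i)
  + \sum_(i < N) \sum_j y j ^+ 2 * (2 * v + s * x j)
  + \sum_i \sum_j (s * y i ^+ 2) * x j
  + \sum_i \sum_j x i * (s * y j ^+ 2)
  + \sum_i \sum_j (- 2 * (x i * y i ^+ 2)) * x j
  + \sum_i \sum_j x i * (- 2 * (x j * y j ^+ 2))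
  + \sum_i \sum_j (- 4 * v * y i) * y j
  + \sum_i \sum_j (- 2 * s * (x i * y i)) * y j
  + \sum_i \sum_j y i * (- 2 * s * (x j * y j))
  + \sum_i \sum_j (4 * (x i * y i)) * (x j * y j)
  + \sum_i \sum_j (- 2) * (a i j * ((x j - x i) ^+ 3 * (y i - y j)))
  + \sum_i \sum_j a i j * (x j - x i) ^+ 4.
  rewrite -!big_split /=; apply: eq_bigr => i _; rewrite -!big_split /=.
  apply: eq_bigr => j _.
  have h1 : s * x i = x i ^+ 2 - v by rewrite x_sqr; ring.
  have h2 : s * x j = x j ^+ 2 - v by rewrite x_sqr; ring.
  have -> : a i j * (x j - x i) ^+ 4 = (a i j * a i j) * (x j - x i) ^+ 4 by rewrite a_idem.
  have -> : s * y i ^+ 2 * x j = (s * x j) * y i ^+ 2 by ring.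
  have -> : x i * (s * y j ^+ 2) = (s * x i) * y j ^+ 2 by ring.
  have -> : - 2 * s * (x i * y i) * y j = - 2 * (s * x i) * (y i * y j) by ring.
  have -> : y i * (- 2 * s * (x j * y j)) = - 2 * (s * x j) * (y i * y j) by ring.
  by rewrite /form_incr h1 h2; ring.
have e11 : \sum_i \sum_j (- 2) * (a i j * ((x j - x i) ^+ 3 * (y i - y j))) =
   - 2 * (\sum_i \sum_j a i j * ((x j - x i) ^+ 3 * (y i - y j))).
  by rewrite [RHS]mulr_sumr; apply: eq_bigr => i _; rewrite [RHS]mulr_sumr.
rewrite e11 !sum_dprod sum_one_r sum_one_l x_sum -!mulr_sumr.
ring.
Qed.

End QuadraticForm.

(** * Counting in the graph *)

Section Adjacency.
Variables (R : realType) (N : nat) (G : graph N).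
Hypothesis hG : simple_graph G.

Definition adj (i j : 'I_N) : R := ([set i; j]%SET \in G)%:R.

Lemma adj_sym i j : adj i j = adj j i.
Proof. by rewrite /adj finset.setUC. Qed.

Lemma adj_irr i : adj i i = 0.
Proof.
rewrite /adj; case: (boolP (_ \in G)) => // /hG.
by rewrite cards2 eqxx.
Qed.

Lemma adj_idem i j : adj i j * adj i j = adj i j.
Proof. by rewrite -natrM mulnb andbb. Qed.

Lemma adj_ge0 i j : 0 <= adj i j. Proof. exact: ler0n. Qed.

Lemma adj_le1 i j : adj i j <= 1.
Proof. by rewrite /adj; case: (_ \in G). Qed.

Lemma adj_neq i j : adj i j != 0 -> i != j.
Proof. by apply: contraNneq => ->; rewrite adj_irr. Qed.

(** Each edge is met twice, once for each of its orientations. *)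
Lemma adj_edge_sum (F : {set 'I_N} -> R) :
  \sum_i \sum_j adj i j * F [set i; j]%SET = 2 * \sum_(e in G) F e.
Proof.
have e1 i j : adj i j * F [set i; j]%SET =
    \sum_(e in G) (e == [set i; j]%SET)%:R * F e.
  rewrite /adj; case: (boolP (_ \in G)) => ijG.
    rewrite (bigD1 [set i; j]%SET) //= eqxx mul1r big1 ?addr0 // => e /andP[_ /negbTE ->].
    exact: mul0r.
  rewrite mul0r big1 // => e eG; case: eqP => [ee|_]; last exact: mul0r.
  by rewrite -ee eG in ijG.
under eq_bigr do under eq_bigr do rewrite e1.
rewrite pair_bigA exchange_big mulr_sumr /=; apply: eq_bigr => e eG.
rewrite -mulr_suml -natr_sum; congr (_%:R * _).
have /eqP/cards2P[a [b [ab ->]]] := hG eG.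
have ba : (b, a) != (a, b) by rewrite xpair_eqE negb_and eq_sym ab.
rewrite (bigD1 (a, b)) // (bigD1 (b, a)) //= eqxx finset.setUC eqxx big1 // => -[x y] /= h.
apply/eqP; rewrite eqb0; apply/negP => /eqP e_xy; rewrite !xpair_eqE in h.
have : a \in [set x; y]%SET by rewrite -e_xy !inE eqxx ?orbT.
have : b \in [set x; y]%SET by rewrite -e_xy !inE eqxx ?orbT.
rewrite !inE => /orP[]/eqP bE /orP[]/eqP aE; move: h ab; rewrite -?bE -?aE ?eqxx ?andbF //.
- by rewrite bE aE eqxx.
- by rewrite bE aE eqxx.
Qed.

Local Notation deg := (degree adj).

Lemma degreeE i : deg i = #|incident G i|%:R.
Proof.
have h := adj_edge_sum (fun e => (i \in e)%:R).
have e1 : \sum_k \sum_j adj k j * (i \in [set k; j]%SET)%:R = 2 * deg i.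
  have -> : \sum_k \sum_j adj k j * (i \in [set k; j]%SET)%:R =
     \sum_k \sum_j (k == i)%:R * adj k j + \sum_k \sum_j (j == i)%:R * adj k j.
    rewrite -big_split /=; apply: eq_bigr => k _; rewrite -big_split /=.
    apply: eq_bigr => j _; rewrite !inE ![i == _]eq_sym.
    have [->|kj] := eqVneq k j; first by rewrite adj_irr mul0r !mulr0 addr0.
    have [ki|ki] := eqVneq k i; have [ji|ji] := eqVneq j i; rewrite /= ?mulr1 ?mul1r ?mul0r ?mulr0 ?addr0 ?add0r //.
    by move: kj; rewrite ki ji eqxx.
  under eq_bigr do rewrite -mulr_sumr.
  rewrite sum_delta exchange_big /=.
  under [X in _ + X]eq_bigr do rewrite -mulr_sumr.
  rewrite sum_delta /degree /rowsum mulr_natl mulr2n; congr (_ + _).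
    by apply: eq_bigr => j _; rewrite mulr1.
  by apply: eq_bigr => j _; rewrite mulr1 adj_sym.
rewrite e1 in h; have h2 : 2 != 0 :> R by [].
move/(mulfI h2): h => ->; rewrite -natr_sum; congr (_%:R).
rewrite /incident -sum1_card [LHS]big_mkcond [RHS]big_mkcond /=.
by apply: eq_bigr => e _; rewrite inE; case: (e \in G); case: (i \in e).
Qed.

Lemma nedgesE : nedges adj = #|G|%:R.
Proof.
rewrite /nedges; have := adj_edge_sum (fun=> 1).
rewrite sumr_const => h; rewrite (_ : \sum_i deg i = 2 * #|G|%:R); first by field.
by rewrite -h; apply: eq_bigr.
Qed.

Lemma edges_withinE (S : {set 'I_N}) :
  (edges_within G S)%:R = 2^-1 * \sum_i \sum_j adj i j * ((i \in S)%:R * (j \in S)%:R) :> R.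
Proof.
have := adj_edge_sum (fun e => (e \subset S)%:R).
have -> : \sum_i \sum_j adj i j * ([set i; j]%SET \subset S)%:R =
   \sum_i \sum_j adj i j * ((i \in S)%:R * (j \in S)%:R).
  apply: eq_bigr => i _; apply: eq_bigr => j _; congr (_ * _).
  by rewrite finset.subUset !finset.sub1set -natrM mulnb.
move=> ->; rewrite mulrA mulVf // mul1r -natr_sum; congr (_%:R).
rewrite /edges_within -sum1_card [RHS]big_mkcond [LHS]big_mkcond /=.
by apply: eq_bigr => e _; rewrite inE; case: (e \in G); case: (e \subset S).
Qed.

Lemma degree_natP i : deg i <= deg i ^+ 2.
Proof. by rewrite degreeE -natrX ler_nat; case: #|_| => // k; rewrite expnS expn1 leq_pmulr. Qed.

Lemma degree_ge0 i : 0 <= deg i.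
Proof. by rewrite degreeE. Qed.

Lemma degree_leN i : deg i <= N%:R.
Proof.
rewrite -[X in _ <= X%:R](card_ord N) -sum1_card natr_sum.
apply: ler_sum => j _; rewrite mulr1 /adj.
by case: (_ \in G).
Qed.

Definition sumdeg2 : R := \sum_i deg i ^+ 2.

Lemma nedges_le_sumdeg2 : 2 * nedges adj <= sumdeg2.
Proof. by rewrite -sum_degree; apply: ler_sum => i _; exact: degree_natP. Qed.

Lemma nedges_ge0 : 0 <= nedges adj. Proof. by rewrite nedgesE. Qed.

Lemma sumdeg2_ge0 : 0 <= sumdeg2.
Proof. by apply: sumr_ge0 => i _; exact: sqr_ge0. Qed.

(** Cauchy-Schwarz, from the double sum of [(deg i - deg j) ^+ 2]. *)
Lemma nedges_sqr_le : (2 * nedges adj) ^+ 2 <= N%:R * sumdeg2.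
Proof.
rewrite -sum_degree.
have : 0 <= \sum_i \sum_j (deg i - deg j) ^+ 2.
  by apply: sumr_ge0 => i _; apply: sumr_ge0 => j _; exact: sqr_ge0.
have -> : \sum_i \sum_j (deg i - deg j) ^+ 2 =
    \sum_i \sum_(j < N) deg i ^+ 2 + \sum_(i < N) \sum_j deg j ^+ 2
    + \sum_i \sum_j (- 2 * deg i) * deg j.
  rewrite -!big_split /=; apply: eq_bigr => i _; rewrite -!big_split /=.
  by apply: eq_bigr => j _; ring.
rewrite sum_one_r sum_one_l sum_dprod -mulr_sumr -/sumdeg2; set t := \sum_i deg i.
lra.
Qed.

Definition codeg j k := \sum_i adj i j * adj i k.

(** [((j, k), (i, l))] lists the vertices of the 4-cycle [j, i, k, l] by opposite
pairs. *)
Definition square_tuple (t : ('I_N * 'I_N) * ('I_N * 'I_N)) : bool :=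
  [&& t.1.1 != t.1.2, t.2.1 != t.2.2, [set t.2.1; t.1.1]%SET \in G,
      [set t.2.1; t.1.2]%SET \in G, [set t.2.2; t.1.1]%SET \in G &
      [set t.2.2; t.1.2]%SET \in G].

Definition square_of (t : ('I_N * 'I_N) * ('I_N * 'I_N)) : graph N :=
  [set [set t.1.1; t.2.1]; [set t.2.1; t.1.2]; [set t.1.2; t.2.2]; [set t.2.2; t.1.1]]%SET.

Lemma edge_neq i j : [set i; j]%SET \in G -> i != j.
Proof. by move=> /hG; rewrite cards2; case: eqP. Qed.

Lemma square_of_square t : square_tuple t ->
  (square_of t \subset G) && is_square (square_of t).
Proof.
case: t => -[j k] [i l] /and5P[/= jk il ij ik /andP[lj lk]].
apply/andP; split.
  by rewrite /square_of !finset.subUset !finset.sub1set /= lj ik finset.setUC ij finset.setUC lk.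
apply/existsP; exists j; apply/existsP; exists i; apply/existsP; exists k.
apply/existsP; exists l; rewrite /square_of eqxx andbT /= !inE !negb_or.
rewrite jk il (eq_sym j i) (edge_neq ij) (edge_neq ik) (eq_sym k l) (edge_neq lk).
by rewrite (eq_sym j l) (edge_neq lj).
Qed.

(** The four entries are among the at most four vertices of the square, so at
most [4 ^ 4] tuples give the same square; the exact number is 8. *)
Lemma square_of_fiber (C : graph N) :
  (#|[set t | square_tuple t && (square_of t == C)]%SET| <= 256)%N.
Proof.
have [->|[t0]] := set_0Vmem [set t | square_tuple t && (square_of t == C)]%SET.
  by rewrite cards0.
rewrite inE => /andP[_ /eqP CE].
pose U := [set t0.1.1; t0.1.2; t0.2.1; t0.2.2]%SET.
have U4 : (#|U| <= 4)%N.
  by rewrite /U -!finset.setUA; do 3![rewrite cardsU1; case: (_ \notin _) => /=]; rewrite cards1.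
have CU (t : ('I_N * 'I_N) * ('I_N * 'I_N)) e x : square_of t = C -> e \in C -> x \in e -> x \in U.
  move=> _; rewrite -CE !inE => /orP[/orP[/orP[]|]|]/eqP ->; rewrite !inE => /orP[]/eqP ->;
  by rewrite eqxx ?orbT.
apply: (@leq_trans #|finset.setX (finset.setX U U) (finset.setX U U)|).
  apply: subset_leq_card; apply/fintype.subsetP => -[[j k] [i l]]; rewrite !inE /= => /andP[_ /eqP tC].
  have h1 : [set j; i]%SET \in C by rewrite -tC !inE eqxx ?orbT.
  have h2 : [set k; l]%SET \in C by rewrite -tC !inE eqxx ?orbT.
  have h e x : e \in C -> x \in e -> x \in U := CU _ e x tC.
  have h3 := h _ j h1; have h4 := h _ i h1; have h5 := h _ k h2; have h6 := h _ l h2.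
  by rewrite !inE !eqxx ?orbT in h3 h4 h5 h6; rewrite h3 // h4 // h5 // h6.
rewrite !cardsX; apply: (@leq_trans ((4 * 4) * (4 * 4))) => //.
by rewrite !leq_mul.
Qed.

Lemma square_tuple_count :
  (#|[set t | square_tuple t]%SET| <= 256 * num_squares G)%N.
Proof.
rewrite -sum1_card (partition_big square_of
  (fun C => C \in [set C : graph N | (C \subset G) && is_square C]%SET)) /=; last first.
  by move=> t; rewrite !inE => /square_of_square.
rewrite mulnC -sum_nat_const; apply: leq_sum => C _.
rewrite sum1_card; apply: leq_trans (square_of_fiber C).
by apply: subset_leq_card; apply/fintype.subsetP => t; rewrite !inE -!topredE /= inE.
Qed.

(** The square of [codeg j k] counts pairs [(i, l)] of common neighbours of [j]
and [k].  Pairs with [i = l] are paths of length two centred at [i], the others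
are squares. *)
Lemma codeg_sqr_sum :
  \sum_j \sum_k (if j == k then 0 else codeg j k) ^+ 2 <=
  sumdeg2 + 256 * (num_squares G)%:R.
Proof.
pose b i j k : R := adj i j * adj i k.
have b01 i j k : 0 <= b i j k <= 1.
  by rewrite /b mulr_ge0 ?adj_ge0 // mulr_ile1 ?adj_ge0 ?adj_le1.
apply: (@le_trans _ _ (\sum_j \sum_k ((\sum_i b i j k) +
    \sum_i \sum_l (square_tuple ((j, k), (i, l)))%:R))).
  apply: ler_sum => j _; apply: ler_sum => k _.
  have [_|jk] := eqVneq j k.
    rewrite expr0n /= addr_ge0 ?sumr_ge0 // => i _; last by rewrite sumr_ge0.
    by case/andP: (b01 i j k).
  rewrite expr2 -sum_dprod -big_split /=; apply: ler_sum => i _.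
  rewrite (bigD1 i) //=; apply: lerD.
    have := b01 i j k; rewrite /b => /andP[h0 h1]; exact: ler_piMl.
  rewrite [leRHS](bigD1 i) //= ler_wpDl // ler_sum // => l li.
  rewrite /square_tuple /= jk eq_sym li /= /b /adj -!natrM ler_nat.
  case: ([set i; j]%SET \in G); case: ([set i; k]%SET \in G);
  case: ([set l; j]%SET \in G); case: ([set l; k]%SET \in G);
  by [].
under eq_bigr do rewrite big_split.
rewrite big_split /=; apply: lerD.
  have -> : \sum_j \sum_k \sum_i b i j k = \sum_i \sum_j \sum_k b i j k.
    under eq_bigr do rewrite exchange_big; by rewrite exchange_big.
  apply: ler_sum => i _; rewrite expr2 /degree /rowsum -sum_dprod.
  apply: ler_sum => j _; apply: ler_sum => k _; by rewrite !mulr1.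
have -> : \sum_j \sum_k \sum_i \sum_l (square_tuple ((j, k), (i, l)))%:R =
    \sum_t (square_tuple t)%:R :> R.
  rewrite (pair_bigA _ (fun j k => \sum_i \sum_l (square_tuple ((j, k), (i, l)))%:R)) /=.
  under eq_bigr => s _ do
    rewrite (pair_bigA _ (fun i l => (square_tuple ((s.1, s.2), (i, l)))%:R)) /=.
  rewrite (pair_bigA _ (fun s t => (square_tuple ((s.1, s.2), (t.1, t.2)))%:R)) /=.
  by apply: eq_bigr => -[[j k] [i l]] _.
rewrite -natr_sum -natrM ler_nat.
apply: leq_trans square_tuple_count; rewrite -sum1_card [leqRHS]big_mkcond /=.
by apply: leq_sum => t _; rewrite inE; case: (square_tuple t).
Qed.

End Adjacency.

(** * The weighted edge count and its increments under swaps *)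

Section GraphStatistic.
Variables (R : realType) (N m n : nat) (G : graph N).
Hypothesis hmn : (m + n)%N = N.
Hypothesis N12 : (12 <= N)%N.
Hypothesis hG : simple_graph G.
Implicit Types X : {set 'I_N}.

Local Notation E := (@perm_E R N m).
Local Notation a := (@adj R N G).
Local Notation d := (degree a).
Local Notation g := (nedges a).
Local Notation x X := (@ctr R N m X).
Local Notation p := (prob1 R N m).
Local Notation v := (p * (1 - p)).
Local Notation s := ((1 - p) - p).
Local Notation K := (slice_const R).
Local Notation D2 := (sumdeg2 R G).
Local Notation Sq := ((num_squares G)%:R : R).

(** The coefficient of the linear term left in [R_w] after centring. *)
Definition kappa : R := s / (N%:R - 2).
Local Notation ka := kappa.

Definition centered_stat X := form_stat a (x X) v ka.
Definition swap_incr X i j := form_incr a (x X) ka i j.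

Let mN : (m <= N)%N. Proof. by rewrite -hmn leq_addr. Qed.
Let N12R : 12 <= N%:R :> R. Proof. by rewrite (ler_nat _ 12). Qed.
Let kaE : ka * (N%:R - 2) = s.
Proof. by rewrite /kappa divfK //; apply: lt0r_neq0; have := N12R; lra. Qed.
Let N1 : N%:R - 1 != 0 :> R.
Proof. by apply: lt0r_neq0; have := N12R; lra. Qed.
Let asym := adj_sym R G.
Let airr := @adj_irr R N G hG.
Let aidem := adj_idem R G.
Let xsum X : #|X| = m -> \sum_i x X i = 0 := @ctr_sum R N m N12 X.
Let xsqr X i : x X i ^+ 2 = v + s * x X i := ctr_sqr R m X i.

Lemma ctr_swap_perturb i j X : x (swap i j X) =
  (fun k => x X k + (x X j - x X i) * ((k == i)%:R - (k == j)%:R)).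
Proof.
apply/funext => k; rewrite ctr_swap.
have [->|ki] := eqVneq k i.
  rewrite tpermL; have [->|_] := eqVneq i j; first by rewrite subrr mul0r addr0.
  by rewrite subr0 mulr1 subrKC.
have [->|kj] := eqVneq k j; first by rewrite tpermR sub0r mulrN1 opprB subrKC.
by rewrite tpermD 1?eq_sym // subrr mulr0 addr0.
Qed.

Lemma centered_stat_swap i j X : centered_stat (swap i j X) = centered_stat X + swap_incr X i j.
Proof.
rewrite /centered_stat /form_stat ctr_swap_perturb (qform_perturb asym airr) lform_perturb.
rewrite /swap_incr /form_incr; ring.
Qed.

Lemma sum_swap_incr X : #|X| = m ->
  \sum_i \sum_j swap_incr X i j = - (4 * (N%:R - 1)) * centered_stat X.
Proof. by move=> Xm; exact: (sum_form_incr asym (xsum Xm) (xsqr X) kaE N1). Qed.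

(** Increments have mean 0, and they add up to a nonzero multiple of the
statistic. *)
Lemma E_centered_stat : E centered_stat = 0.
Proof.
have h : E (fun X => \sum_i \sum_j swap_incr X i j) = 0.
  rewrite perm_E_sum big1 // => i _; rewrite perm_E_sum big1 // => j _.
  have -> : E (fun X => swap_incr X i j) = E (fun X => centered_stat (swap i j X) - centered_stat X).
    by apply: perm_E_eq => X _; rewrite centered_stat_swap addrAC subrr add0r.
  by rewrite perm_EB perm_E_swap subrr.
move: h; rewrite (perm_E_eq (fun X Xm => sum_swap_incr Xm)) perm_EZ => /eqP.
rewrite mulf_eq0 oppr_eq0 mulf_eq0 (negbTE N1) orbF => /orP[|/eqP //].
by rewrite pnatr_eq0.
Qed.

(** Expand the indicators as [p + x_i] and [(1 - p) - x_i]; both classes of edges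
contribute the same quadratic form, and the weights add up to 1. *)
Lemma R_w_affine_stat : exists c : R, forall X, #|X| = m -> R_w R m n G X = centered_stat X + c.
Proof.
have qE : 1 - p = n%:R / N%:R by exact: probC.
have N0 : N%:R != 0 :> R by apply: lt0r_neq0; have := N12R; lra.
have N2 : N%:R - 2 != 0 :> R by apply: lt0r_neq0; have := N12R; lra.
have mE : m%:R = p * N%:R by rewrite /prob1 divfK.
have nE : n%:R = (1 - p) * N%:R by rewrite qE divfK.
exists ((n%:R - 1) / (N%:R - 2) * (p ^+ 2 * g) + (m%:R - 1) / (N%:R - 2) * ((1 - p) ^+ 2 * g)
   - v * g / (N%:R - 1)) => X Xm.
have e1 (y : 'I_N -> R) c :
    2^-1 * (\sum_i \sum_j a i j * ((c + y i) * (c + y j))) =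
    c ^+ 2 * g + c * lform a y + qform a y.
  have -> : \sum_i \sum_j a i j * ((c + y i) * (c + y j)) =
     c ^+ 2 * (2 * g) + c * lform a y + c * lform a y + 2 * qform a y.
    rewrite -sum_degree -[X in _ + c * X + _](sum_rowsum asym) -sum_x_rowsum.
    rewrite !mulr_sumr -!big_split /=; apply: eq_bigr => i _.
    rewrite /degree /rowsum !mulr_suml !mulr_sumr -!big_split /=.
    by apply: eq_bigr => j _; ring.
  by field.
have h1 : (edges_within G X)%:R = p ^+ 2 * g + p * lform a (x X) + qform a (x X).
  rewrite (edges_withinE R hG) -e1; congr (_ * _).
  by apply: eq_bigr => i _; apply: eq_bigr => j _; rewrite /ctr !subrKC.
have h2 : (edges_within G (~: X)%SET)%:R =
    (1 - p) ^+ 2 * g - (1 - p) * lform a (x X) + qform a (x X).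
  have -> : (1 - p) ^+ 2 * g - (1 - p) * lform a (x X) + qform a (x X) =
     (1 - p) ^+ 2 * g + (1 - p) * lform a (fun i => - x X i) + qform a (fun i => - x X i).
    have -> : lform a (fun i => - x X i) = - lform a (x X).
      by rewrite /lform -sumrN; apply: eq_bigr => i _; rewrite mulrN.
    have -> : qform a (fun i => - x X i) = qform a (x X).
      rewrite /qform; congr (_ * _); apply: eq_bigr => i _; rewrite /rowsum mulNr -mulrN; congr (_ * _).
      by rewrite -sumrN; apply: eq_bigr => j _; rewrite mulrN opprK.
    by ring.
  rewrite (edges_withinE R hG) -e1; congr (_ * _).
  apply: eq_bigr => i _; apply: eq_bigr => j _; congr (_ * (_ * _)).
    by rewrite /ctr inE; case: (i \in X); rewrite /= ?mulr1n ?mulr0n; ring.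
  by rewrite /ctr inE; case: (j \in X); rewrite /= ?mulr1n ?mulr0n; ring.
rewrite /R_w h1 h2 /centered_stat /form_stat /kappa mE nE.
by field; rewrite N1 N2.
Qed.

Lemma R_w_centered X : #|X| = m -> R_w R m n G X - E (R_w R m n G) = centered_stat X.
Proof.
have [c h] := R_w_affine_stat => Xm.
rewrite h // (perm_E_eq h) perm_ED E_centered_stat perm_E_cst //; ring.
Qed.

Lemma perm_Var_R_w : perm_Var m (R_w R m n G) = E (fun X => centered_stat X ^+ 2).
Proof. by apply: perm_E_eq => X Xm; rewrite R_w_centered. Qed.

Let K0 : 1 <= K. Proof. by rewrite /slice_const exprn_ege1 // ler1n. Qed.
#[local] Opaque slice_const.
Let v0 : 0 <= v. Proof. exact: (var_ge0 R hmn N12). Qed.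
Let vs1 : v + `|s| <= 1. Proof. exact: (var_skew_le1 R hmn N12). Qed.
Let v1 : v <= 1. Proof. by apply: le_trans vs1; rewrite lerDl. Qed.
Let s1 : `|s| <= 1. Proof. by apply: le_trans vs1; rewrite lerDr. Qed.
Let d0 i : 0 <= d i := degree_ge0 R hG i.
Let D0 : 0 <= D2 := sumdeg2_ge0 R G.
Let g0 : 0 <= g := nedges_ge0 R hG.
Let gD : 2 * g <= D2 := nedges_le_sumdeg2 R hG.

Lemma kappa_le : `|ka| <= 2 / N%:R.
Proof.
have h := N12R; rewrite /kappa normrM normfV.
rewrite (ger0_norm (_ : 0 <= N%:R - 2)); last by lra.
apply: (@le_trans _ _ (1 / (N%:R - 2))); first by rewrite ler_pM2r ?invr_gt0 //; lra.
rewrite ler_pdivrMr; last by lra.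
rewrite mulrAC ler_pdivlMr; last by lra.
lra.
Qed.

Lemma kappaN : `|ka| * N%:R <= 2.
Proof. by rewrite -ler_pdivlMr ?kappa_le //; have := N12R; lra. Qed.

Local Notation L X := (lform a (x X)).
Local Notation Q X := (qform a (x X)).
Local Notation T X := (rowsum a (x X)).
Local Notation O X i := (offdiag a (x X) i).
Local Notation y X := (fun i => T X i + ka * d i).

Lemma E_lform_sqr : E (fun X => L X ^+ 2) <= K * D2.
Proof. exact: (slice_linear hmn N12 d). Qed.

Lemma E_rowsum_sqr i : E (fun X => T X i ^+ 2) <= K * d i.
Proof.
apply: le_trans (slice_linear hmn N12 (fun j => a i j)) _.
rewrite ler_pM2l; last by have := K0; lra.
by apply: ler_sum => j _; rewrite mulr1 expr2 aidem.
Qed.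

Lemma E_qform_sqr : E (fun X => Q X ^+ 2) <= K * g.
Proof.
rewrite (_ : E _ = E (fun X => (\sum_i \sum_j (2^-1 * a i j) * (x X i * x X j)) ^+ 2)); last first.
  apply: perm_E_eq => X _; congr (_ ^+ 2); rewrite /qform mulr_sumr.
  apply: eq_bigr => i _; rewrite !mulr_sumr; apply: eq_bigr => j _; ring.
apply: le_trans (slice_quadratic hmn N12 _) _ => [i|]; first by rewrite airr mulr0.
rewrite ler_pM2l; last by have := K0; lra.
rewrite (_ : g = 2^-1 * (2 * g)); last by field.
rewrite -sum_degree mulr_sumr; apply: ler_sum => i _; rewrite mulr_sumr.
apply: ler_sum => j _; rewrite mulr1 exprMn expr2 [a i j ^+ 2]expr2 aidem.
by have := adj_ge0 R G i j; lra.
Qed.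

Lemma E_offdiag_sqr i : E (fun X => O X i ^+ 2) <= K * d i ^+ 2.
Proof.
rewrite (_ : E _ = E (fun X =>
   (\sum_j \sum_k (if j == k then 0 else a i j * a i k) * (x X j * x X k)) ^+ 2)); last first.
  apply: perm_E_eq => X _; congr (_ ^+ 2); apply: eq_bigr => j _.
  by apply: eq_bigr => k _; case: eqP => _; rewrite ?mul0r.
apply: le_trans (slice_quadratic hmn N12 _) _ => [j|]; first by rewrite eqxx.
rewrite ler_pM2l; last by have := K0; lra.
rewrite expr2 -sum_dprod; apply: ler_sum => j _; apply: ler_sum => k _.
rewrite !mulr1; have h := mulr_ge0 (adj_ge0 R G i j) (adj_ge0 R G i k).
case: eqP => _; first by rewrite expr0n.
by rewrite expr2 mulrACA !aidem.
Qed.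

Lemma E_sum_offdiag_sqr : E (fun X => (\sum_i O X i) ^+ 2) <= K * (D2 + 256 * Sq).
Proof.
rewrite (_ : E _ = E (fun X =>
   (\sum_j \sum_k (if j == k then 0 else codeg R G j k) * (x X j * x X k)) ^+ 2)); last first.
  apply: perm_E_eq => X _; congr (_ ^+ 2); rewrite exchange_big /=; apply: eq_bigr => j _.
  rewrite exchange_big /=; apply: eq_bigr => k _; rewrite /codeg.
  case: eqP => _; first by rewrite mul0r big1.
  by rewrite mulr_suml; apply: eq_bigr => i _; rewrite (asym i j).
apply: le_trans (slice_quadratic hmn N12 _) _ => [j|]; first by rewrite eqxx.
by rewrite ler_pM2l ?codeg_sqr_sum //; have := K0; lra.
Qed.

Lemma E_cubic_sqr : E (fun X => (\sum_i x X i * O X i) ^+ 2) <= K * D2.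
Proof.
rewrite (_ : E _ = E (fun X => (\sum_i \sum_j \sum_k
   (if j == k then 0 else a i j * a i k) * (x X i * x X j * x X k)) ^+ 2)); last first.
  apply: perm_E_eq => X _; congr (_ ^+ 2); apply: eq_bigr => i _.
  rewrite /offdiag mulr_sumr; apply: eq_bigr => j _; rewrite mulr_sumr.
  by apply: eq_bigr => k _; case: eqP => _; [rewrite mulr0 mul0r|ring].
apply: le_trans (slice_cubic hmn N12 _) _ => [i j k|].
  have [_|jk] := eqVneq j k; first by rewrite eqxx.
  rewrite mulf_eq0 negb_or => /andP[/(adj_neq hG) -> /(adj_neq hG) ->].
  by rewrite andbT.
rewrite ler_pM2l; last by have := K0; lra.
apply: ler_sum => i _.
rewrite expr2 -sum_dprod; apply: ler_sum => j _; apply: ler_sum => k _.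
rewrite !mulr1; have h := mulr_ge0 (adj_ge0 R G i j) (adj_ge0 R G i k).
case: eqP => _; first by rewrite expr0n.
by rewrite expr2 mulrACA !aidem.
Qed.

(** Bounding [sqrt (K * d i)] by [K * d i] is lossy, but only enters multiplied
by [d i], and [d i ^+ 2] is what the hypothesis controls. *)
Lemma E_norm_rowsum i : E (fun X => `|T X i|) <= K * d i.
Proof.
apply: le_trans (perm_E_norm_le mN (E_rowsum_sqr i)) _.
have Kd : 0 <= K * d i by rewrite mulr_ge0 //; have := K0; lra.
rewrite -[leRHS](ger0_norm Kd) -sqrtr_sqr ler_wsqrtr // exprMn.
apply: (@le_trans _ _ (K * d i ^+ 2)).
  by rewrite ler_pM2l ?degree_natP //; have := K0; lra.
by rewrite ler_wpM2r ?sqr_ge0 //; have := K0; nra.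
Qed.

Let ka1 : `|ka| <= 1.
Proof.
apply: le_trans kappa_le _; have := N12R => h; rewrite ler_pdivrMr; lra.
Qed.

Let xle1 X i : `|x X i| <= 1.
Proof. exact: (ctr_norm R hmn N12). Qed.

Let du_le1 X i j : `|x X j - x X i| <= 1.
Proof.
have -> : x X j - x X i = (j \in X)%:R - (i \in X)%:R by rewrite /ctr; ring.
case: (j \in X); case: (i \in X);
  rewrite ?mulr1n ?mulr0n /= ler_norml; apply/andP; split; lra.
Qed.

Lemma weight_le2 X i : `|2 * v + s * x X i| <= 2.
Proof.
have h1 := vs1; have h2 := v0; have h3 : `|s * x X i| <= `|s|.
  by rewrite normrM ler_piMr.
rewrite ler_norml; move: h3; rewrite ler_norml => /andP[? ?]; apply/andP; split; lra.
Qed.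

Lemma E_rowsum_pow4 i : E (fun X => T X i ^+ 4) <= 9 * K * d i ^+ 2.
Proof.
apply: (@le_trans _ _ (E (fun X => 3 * (d i ^+ 2 + T X i ^+ 2 + O X i ^+ 2)))).
  apply: perm_E_le => X Xm.
  have -> : T X i ^+ 4 = (T X i ^+ 2) ^+ 2 by ring.
  rewrite {1}(rowsum_sqr aidem (xsqr X)).
  have h1 : (v * d i) ^+ 2 <= d i ^+ 2.
    by rewrite exprMn ler_piMl ?sqr_ge0 // expr_le1.
  have h2 : (s * T X i) ^+ 2 <= T X i ^+ 2.
    by rewrite exprMn ler_piMl ?sqr_ge0 // -real_normK ?num_real // expr_le1.
  have := sqr_ge0 (v * d i - s * T X i); have := sqr_ge0 (v * d i - O X i).
  have := sqr_ge0 (s * T X i - O X i).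
  move: h1 h2; set A1 := v * d i; set A2 := s * T X i; set A3 := O X i; nra.
rewrite perm_EZ 2!perm_ED perm_E_cst //.
have h1 := E_rowsum_sqr i; have h2 := E_offdiag_sqr i; have h3 := degree_natP R hG i.
have h4 := K0.
have h5 : K * d i <= K * d i ^+ 2 by rewrite ler_pM2l //; lra.
have h6 : d i ^+ 2 <= K * d i ^+ 2 by rewrite ler_peMl ?sqr_ge0.
lra.
Qed.

Lemma E_norm_y i : E (fun X => `|y X i|) <= 2 * K * d i.
Proof.
apply: (@le_trans _ _ (E (fun X => `|T X i| + d i))).
  apply: perm_E_le => X _; apply: le_trans (ler_normD _ _) _; rewrite lerD2l.
  by rewrite normrM (ger0_norm (d0 i)) ler_piMl.
rewrite perm_ED perm_E_cst //; have := E_norm_rowsum i; have h := d0 i; have := K0; nra.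
Qed.

(** Third absolute moments are interpolated by [t ^+ 3 <= t ^+ 2 + t ^+ 4]. *)
Lemma E_norm_y3 i : E (fun X => `|y X i| ^+ 3) <= 44 * K * d i ^+ 2.
Proof.
have kd : `|ka * d i| ^+ 3 <= d i ^+ 2.
  have h1 : `|ka * d i| <= 2.
    rewrite normrM (ger0_norm (d0 i)); apply: le_trans kappaN.
    by rewrite ler_wpM2l // degree_leN.
  have h2 : `|ka * d i| ^+ 2 <= d i ^+ 2 / 2.
    rewrite normrM exprMn (ger0_norm (d0 i)) mulrC ler_wpM2l ?sqr_ge0 //.
    (* 2 / N is at most 1 / 6 *)
    apply: (@le_trans _ _ ((6^-1) ^+ 2)); last by lra.
    rewrite ler_pXn2r ?nnegrE ?invr_ge0 //.
    apply: le_trans kappa_le _; have h := N12R; rewrite ler_pdivrMr; lra.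
  rewrite exprS; apply: (@le_trans _ _ (2 * (d i ^+ 2 / 2))); last by lra.
  by apply: ler_pM.
apply: (@le_trans _ _ (E (fun X => 4 * (T X i ^+ 2 + T X i ^+ 4 + d i ^+ 2)))).
  apply: perm_E_le => X _.
  have h : `|y X i| <= `|T X i| + `|ka * d i| by exact: ler_normD.
  have h3 : `|y X i| ^+ 3 <= (`|T X i| + `|ka * d i|) ^+ 3.
    by rewrite ler_pXn2r ?nnegrE ?addr_ge0.
  apply: (le_trans h3).
  have -> : T X i ^+ 4 = `|T X i| ^+ 4 by rewrite -normrX ger0_norm // exprn_even_ge0.
  have -> : T X i ^+ 2 = `|T X i| ^+ 2 by rewrite real_normK ?num_real.
  move: kd (normr_ge0 (T X i)) (normr_ge0 (ka * d i)).
  set t := `|T X i|; set c := `|ka * d i| => kd t0 c0.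
  have h4 : (t + c) ^+ 3 <= 4 * (t ^+ 3 + c ^+ 3).
    rewrite -subr_ge0.
    have -> : 4 * (t ^+ 3 + c ^+ 3) - (t + c) ^+ 3 = 3 * ((t + c) * (t - c) ^+ 2) by ring.
    by rewrite mulr_ge0 // mulr_ge0 ?addr_ge0 ?sqr_ge0.
  have h5 : t ^+ 3 <= t ^+ 2 + t ^+ 4.
    have -> : t ^+ 2 + t ^+ 4 = t ^+ 3 + t ^+ 2 * (1 - t + t ^+ 2) by ring.
    by rewrite lerDl mulr_ge0 ?sqr_ge0 //; nra.
  lra.
rewrite perm_EZ 2!perm_ED perm_E_cst //.
have h1 := E_rowsum_sqr i; have h2 := E_rowsum_pow4 i; have h3 := degree_natP R hG i.
have h4 := K0.
have h5 : K * d i <= K * d i ^+ 2 by rewrite ler_pM2l //; lra.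
have h6 : d i ^+ 2 <= K * d i ^+ 2 by rewrite ler_peMl ?sqr_ge0.
lra.
Qed.

Lemma E_swap_incr3 :
  E (fun X => \sum_i \sum_j `|swap_incr X i j| ^+ 3) <= 900 * K * N%:R * D2.
Proof.
apply: (@le_trans _ _ (E (fun X =>
   \sum_i \sum_j 9 * (`|y X i| ^+ 3 + `|y X j| ^+ 3 + a i j)))).
  apply: perm_E_le => X _; apply: ler_sum => i _; apply: ler_sum => j _.
  have h : `|swap_incr X i j| <= `|y X i| + `|y X j| + a i j.
    rewrite /swap_incr /form_incr; apply: le_trans (ler_normB _ _) _; apply: lerD.
      rewrite normrM; apply: (@le_trans _ _ (1 * (`|y X i| + `|y X j|))); last by rewrite mul1r.
      by apply: ler_pM => //; exact: ler_normB.
    rewrite normrM (ger0_norm (adj_ge0 R G i j)) ler_piMr ?adj_ge0 //.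
    by rewrite normrX expr_le1.
  have h3 : `|swap_incr X i j| ^+ 3 <= (`|y X i| + `|y X j| + a i j) ^+ 3.
    by rewrite ler_pXn2r ?nnegrE ?addr_ge0 ?adj_ge0.
  apply: (le_trans h3).
  have a3 : a i j = a i j ^+ 3 by rewrite !exprS expr0 mulr1 !aidem.
  rewrite [in leRHS]a3.
  move: (normr_ge0 (y X i)) (normr_ge0 (y X j)) (adj_ge0 R G i j).
  set t := `|y X i|; set c := `|y X j|; set b := a i j => t0 c0 b0.
  rewrite -subr_ge0.
  (* convexity of the cube, with an explicit nonnegative remainder *)
  have -> : 9 * (t ^+ 3 + c ^+ 3 + b ^+ 3) - (t + c + b) ^+ 3 =
     3 * ((t + c) * (t - c) ^+ 2 + (t + b) * (t - b) ^+ 2 + (c + b) * (c - b) ^+ 2)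
     + (t + c + b) * ((t - c) ^+ 2 + (t - b) ^+ 2 + (c - b) ^+ 2) by ring.
  have h0 (z1 z2 z3 : R) : 0 <= z1 -> 0 <= z2 -> 0 <= (z1 + z2) * z3 ^+ 2.
    by move=> ? ?; rewrite mulr_ge0 ?addr_ge0 ?sqr_ge0.
  have := h0 t c (t - c) t0 c0; have := h0 t b (t - b) t0 b0; have := h0 c b (c - b) c0 b0.
  have s0 : 0 <= (t + c + b) * ((t - c) ^+ 2 + (t - b) ^+ 2 + (c - b) ^+ 2).
    by rewrite mulr_ge0 ?addr_ge0 ?sqr_ge0.
  lra.
rewrite (_ : E _ = E (fun X => 9 * (2 * (N%:R * \sum_i `|y X i| ^+ 3) + 2 * g))); last first.
  apply: perm_E_eq => X _.
  have -> : 2 * (N%:R * \sum_i `|y X i| ^+ 3) + 2 * g =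
     \sum_i \sum_(j < N) `|y X i| ^+ 3 + \sum_(i < N) \sum_j `|y X j| ^+ 3 + \sum_i \sum_j a i j.
    rewrite sum_one_r sum_one_l -sum_degree mulr_natl mulr2n; congr (_ + _).
    by apply: eq_bigr => i _; apply: eq_bigr => j _; rewrite mulr1.
  rewrite -!big_split [RHS]mulr_sumr /=; apply: eq_bigr => i _.
  by rewrite -!big_split [RHS]mulr_sumr.
rewrite perm_EZ perm_ED perm_E_cst // !perm_EZ perm_E_sum.
have h : \sum_i E (fun X => `|y X i| ^+ 3) <= 44 * K * D2.
  by rewrite [leRHS]mulr_sumr; apply: ler_sum => i _; exact: E_norm_y3.
have N0 : 0 <= N%:R :> R by [].
have h2 := ler_wpM2l N0 h; have h3 := gD; have h4 := D0.
have h5 : 12 * D2 <= K * N%:R * D2.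
  by rewrite ler_wpM2r //; have := K0; have := N12R; nra.
have -> : 900 * K * N%:R * D2 = 900 * (K * N%:R * D2) by ring.
have h6 : N%:R * (44 * K * D2) = 44 * (K * N%:R * D2) by ring.
rewrite h6 in h2; lra.
Qed.

(** The deviation of the sum of the squared increments from the value that its
mean would have if the variance of the statistic were [v ^+ 2 * g]. *)
Definition increment_dev X := \sum_i \sum_j swap_incr X i j ^+ 2 - 8 * (N%:R - 1) * v ^+ 2 * g.

Let Zb X := \sum_i (4 * `|ka| * (d i * `|T X i|) + 2 * ka ^+ 2 * d i ^+ 2).

(** The leading part of the sum of the squared increments. *)
Lemma sum_y_sqr_le X : #|X| = m ->
  `|\sum_i y X i ^+ 2 * (2 * v + s * x X i) - 4 * v ^+ 2 * g| <=
  3 * `|L X| + 2 * `|Q X| + 2 * `|\sum_i O X i| + `|\sum_i x X i * O X i| + Zb X.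
Proof.
move=> Xm.
have -> : \sum_i y X i ^+ 2 * (2 * v + s * x X i) =
   \sum_i T X i ^+ 2 * (2 * v + s * x X i) +
   \sum_i (2 * ka * (d i * T X i) + ka ^+ 2 * d i ^+ 2) * (2 * v + s * x X i).
  by rewrite -big_split; apply: eq_bigr => i _ /=; ring.
have Zle : `|\sum_i (2 * ka * (d i * T X i) + ka ^+ 2 * d i ^+ 2) * (2 * v + s * x X i)| <= Zb X.
  apply: le_trans (ler_norm_sum _ _ _) _; apply: ler_sum => i _.
  rewrite normrM.
  have h1 : `|2 * ka * (d i * T X i) + ka ^+ 2 * d i ^+ 2| <=
     2 * `|ka| * (d i * `|T X i|) + ka ^+ 2 * d i ^+ 2.
    apply: le_trans (ler_normD _ _) _; apply: lerD.
      by rewrite !normrM (ger0_norm (d0 i)) ger0_norm.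
    by rewrite ger0_norm // mulr_ge0 ?sqr_ge0.
  apply: le_trans (ler_pM (normr_ge0 _) (normr_ge0 _) h1 (weight_le2 X i)) _.
  by rewrite le_eqVlt; apply/orP; left; apply/eqP; ring.
rewrite (sum_rowsum_sqr asym aidem (xsqr X)).
move: Zle; set Z := \sum_i (_ + _) * _; set o := \sum_i O X i; set c := \sum_i x X i * _.
have vs (w : R) : 0 <= w <= 1 -> forall z : R, - `|z| <= w * z <= `|z|.
  move=> /andP[w0 w1] z; rewrite -ler_norml normrM (ger0_norm w0); exact: ler_piMl.
have sz (z : R) : - `|z| <= s * z <= `|z|.
  by rewrite -ler_norml normrM ler_piMl.
have /andP[v1' v2'] := vs v (introT andP (conj v0 v1)) (s * L X).
have /andP[w1 w2] := vs v (introT andP (conj v0 v1)) o.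
have /andP[c1 c2] := sz c.
have sL : `|s * L X| <= `|L X| by rewrite normrM ler_piMl.
have sQ : `|s ^+ 2 * Q X| <= `|Q X|.
  by rewrite normrM ler_piMl // normrX expr_le1.
have /andP[q1 q2] : - `|Q X| <= s ^+ 2 * Q X <= `|Q X| by rewrite -ler_norml.
rewrite ler_norml => /andP[z1 z2].
rewrite (_ : 4 * v ^+ 2 * g + _ + _ + _ + _ + Z - _ = 3 * (v * (s * L X)) +
  2 * (s ^+ 2 * Q X) + 2 * (v * o) + s * c + Z); last by ring.
by rewrite ler_norml; apply/andP; split; lra.
Qed.

Lemma increment_dev_le X : #|X| = m ->
  `|increment_dev X| <= 10 * g + 2 * N%:R *
    (3 * `|L X| + 2 * `|Q X| + 2 * `|\sum_i O X i| + `|\sum_i x X i * O X i| + Zb X)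
    + 12 * L X ^+ 2 + 48 * ka ^+ 2 * g ^+ 2 + 48 * Q X ^+ 2 + 12 * L X ^+ 2
    + 4 * \sum_i d i * `|y X i|.
Proof.
move=> Xm.
have h1 := sum_y_sqr_le Xm; set B1 := (3 * _ + _ + _ + _ + _) in h1 *.
rewrite /increment_dev /swap_incr (sum_form_incr_sqr aidem _ (xsum Xm) (xsqr X)).
have -> : \sum_i y X i = L X + 2 * ka * g.
  rewrite big_split /= (sum_rowsum asym) -mulr_sumr sum_degree; ring.
have -> : \sum_i x X i * y X i = 2 * Q X + ka * L X.
  rewrite -sum_x_rowsum mulr_sumr -big_split /=; apply: eq_bigr => i _; ring.
move: h1; set S1 := \sum_i _ ^+ 2 * _ => h1.
have hA : `|\sum_i \sum_j a i j * ((x X j - x X i) ^+ 3 * (y X i - y X j))| <=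
    2 * \sum_i d i * `|y X i|.
  apply: (@le_trans _ _ (\sum_i \sum_j a i j * `|y X i| + \sum_i \sum_j a i j * `|y X j|)).
    rewrite -big_split /=; apply: le_trans (ler_norm_sum _ _ _) _; apply: ler_sum => i _.
    rewrite -big_split /=; apply: le_trans (ler_norm_sum _ _ _) _; apply: ler_sum => j _.
    rewrite normrM (ger0_norm (adj_ge0 R G i j)) -mulrDr ler_wpM2l ?adj_ge0 // normrM.
    rewrite -[leRHS]mul1r; apply: ler_pM => //; last exact: ler_normB.
    by rewrite normrX expr_le1.
  rewrite mulr_natl mulr2n; apply: lerD.
    apply: ler_sum => i _; rewrite -mulr_suml /degree /rowsum le_eqVlt; apply/orP; left.
    by apply/eqP; congr (_ * _); apply: eq_bigr => j _; rewrite mulr1.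
  rewrite exchange_big /=.
  apply: ler_sum => i _; rewrite -mulr_suml /degree /rowsum le_eqVlt; apply/orP; left.
  by apply/eqP; congr (_ * _); apply: eq_bigr => j _; rewrite mulr1 asym.
have hB : 0 <= \sum_i \sum_j a i j * (x X j - x X i) ^+ 4 <= 2 * g.
  apply/andP; split.
    apply: sumr_ge0 => i _; apply: sumr_ge0 => j _; rewrite mulr_ge0 ?adj_ge0 //.
    exact: exprn_even_ge0.
  rewrite -sum_degree; apply: ler_sum => i _; apply: ler_sum => j _.
  rewrite ler_wpM2l ?adj_ge0 // -[leLHS]ger0_norm ?exprn_even_ge0 // normrX.
  by rewrite expr_le1.
move: hA hB; set A := \sum_i \sum_j _; set B := \sum_i \sum_j _.
set S2 := \sum_i _ => hA /andP[B0 B2].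
have h3 : - (2 * N%:R * B1) <= 2 * N%:R * (S1 - 4 * v ^+ 2 * g) <= 2 * N%:R * B1.
  have N20 : 0 <= 2 * N%:R :> R by rewrite mulr_ge0.
  by rewrite -ler_norml normrM (ger0_norm N20) ler_wpM2l.
have h4 : 0 <= v ^+ 2 * g <= g.
  by rewrite mulr_ge0 ?sqr_ge0 //= ler_piMl // expr_le1.
set Y1 := L X + _; set Y2 := 2 * Q X + _.
have hY1 : Y1 ^+ 2 <= 2 * L X ^+ 2 + 8 * ka ^+ 2 * g ^+ 2.
  have := sqr_ge0 (L X - 2 * ka * g); rewrite /Y1; nra.
have hY2 : Y2 ^+ 2 <= 8 * Q X ^+ 2 + 2 * L X ^+ 2.
  have h5 : (ka * L X) ^+ 2 <= L X ^+ 2.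
    by rewrite exprMn ler_piMl ?sqr_ge0 // -real_normK ?num_real // expr_le1.
  have := sqr_ge0 (2 * Q X - ka * L X); rewrite /Y2; move: h5; set z := ka * L X; nra.
have h6 : 0 <= v * Y1 ^+ 2 <= Y1 ^+ 2.
  by rewrite mulr_ge0 ?sqr_ge0 //= ler_piMl ?sqr_ge0.
have h7 : - (Y1 ^+ 2 + Y2 ^+ 2) <= 2 * (s * (Y1 * Y2)) <= Y1 ^+ 2 + Y2 ^+ 2.
  rewrite -ler_norml normrM (ger0_norm (_ : 0 <= 2)) //.
  apply: (@le_trans _ _ (2 * `|Y1 * Y2|)).
    by rewrite ler_pM2l // normrM ler_piMl.
  have := sqr_ge0 (`|Y1| - `|Y2|); rewrite normrM -[Y1 ^+ 2]real_normK ?num_real //.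
  rewrite -[Y2 ^+ 2]real_normK ?num_real //; nra.
have q1 := sqr_ge0 Y1; have q2 := sqr_ge0 Y2.
move: hA; rewrite ler_norml => /andP[A1 A2].
move: h3 h4 h6 h7 => /andP[? ?] /andP[? ?] /andP[? ?] /andP[? ?].
rewrite (_ : 2 * N%:R * S1 - _ - _ + _ - _ + B - _ = 2 * N%:R * (S1 - 4 * v ^+ 2 * g)
  + 8 * (v ^+ 2 * g) - 4 * (v * Y1 ^+ 2) - 2 * (2 * (s * (Y1 * Y2))) + 4 * Y2 ^+ 2
  - 2 * A + B); last by ring.
rewrite ler_norml; apply/andP; split; lra.
Qed.

(** A common [L2] bound for the polynomials in [sum_y_sqr_le]; the number of
squares enters through the one with coefficients [codeg]. *)
Definition fluctuation : R := Num.sqrt (K * (D2 + 256 * Sq)).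

Lemma E_increment_dev : E (fun X => `|increment_dev X|) <= 16 * N%:R * fluctuation + 200 * K * D2.
Proof.
apply: le_trans (perm_E_le increment_dev_le) _.
rewrite /Zb.
have nrm f : E (fun X => f X ^+ 2) <= K * (D2 + 256 * Sq) -> E (fun X => `|f X|) <= fluctuation.
  exact: perm_E_norm_le.
have K1 := K0.
have DS : D2 <= D2 + 256 * Sq by rewrite lerDl mulr_ge0.
have KDS : K * D2 <= K * (D2 + 256 * Sq) by rewrite ler_pM2l //; lra.
have gD' : g <= D2 by have := gD; have := g0; lra.
have hL := nrm _ (le_trans E_lform_sqr KDS).
have hQ : E (fun X => `|Q X|) <= fluctuation.
  apply: nrm; apply: le_trans E_qform_sqr _; apply: le_trans KDS.
  by rewrite ler_pM2l //; lra.
have hO := nrm _ E_sum_offdiag_sqr.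
have hC := nrm _ (le_trans E_cubic_sqr KDS).
have hZ : E (fun X => \sum_i (4 * `|ka| * (d i * `|T X i|) + 2 * ka ^+ 2 * d i ^+ 2))
     <= 6 * `|ka| * K * D2.
  rewrite perm_E_sum [leRHS]mulr_sumr; apply: ler_sum => i _.
  rewrite perm_ED perm_E_cst // !perm_EZ.
  have h1 : d i * E (fun X => `|T X i|) <= K * d i ^+ 2.
    by rewrite expr2 mulrCA ler_wpM2l // E_norm_rowsum.
  have h2 : ka ^+ 2 <= `|ka| * K.
    rewrite -real_normK ?num_real // expr2; apply: ler_wpM2l => //.
    exact: le_trans ka1 K1.
  have h3 := ler_wpM2l (normr_ge0 ka) h1.
  have h4 := ler_wpM2r (sqr_ge0 (d i)) h2.
  lra.
have hy : E (fun X => \sum_i d i * `|y X i|) <= 2 * K * D2.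
  rewrite perm_E_sum [leRHS]mulr_sumr; apply: ler_sum => i _; rewrite perm_EZ.
  by rewrite [d i ^+ 2]expr2 mulrCA ler_wpM2l // E_norm_y.
have hkg : ka ^+ 2 * g ^+ 2 <= D2.
  have h1 : 4 * g ^+ 2 <= N%:R * D2.
    by have := nedges_sqr_le R G; lra.
  have h2 : ka ^+ 2 * N%:R ^+ 2 <= 4.
    rewrite -real_normK ?num_real // -exprMn; have := kappaN.
    have : 0 <= `|ka| * N%:R by rewrite mulr_ge0.
    set z := _ * N%:R; nra.
  have h3 : ka ^+ 2 * (4 * g ^+ 2) <= ka ^+ 2 * (N%:R * D2) by rewrite ler_wpM2l ?sqr_ge0.
  have h4 : ka ^+ 2 * N%:R <= 4.
    apply: le_trans h2; rewrite ler_wpM2l ?sqr_ge0 // expr2 ler_peMl //; have := N12R; lra.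
  have h5 := ler_wpM2r D0 h4.
  lra.
rewrite !perm_ED !perm_EZ !perm_ED !perm_EZ !perm_E_cst //.
have hN : N%:R * (`|ka| * (K * D2)) <= 2 * (K * D2).
  have KD0 : 0 <= K * D2 by apply: mulr_ge0 => //; lra.
  rewrite mulrA ler_wpM2r //.
  by rewrite mulrC kappaN.
have hDK : D2 <= K * D2 by rewrite ler_peMl.
have hgK : K * g <= K * D2 by rewrite ler_pM2l //; lra.
have e1 := E_lform_sqr; have e2 := E_qform_sqr.
move: hL hQ hO hC hZ; set eL := E _; set eQ := E _; set eO := E _; set eC := E _.
set eZ := E _ => hL hQ hO hC hZ.
have hin : 2 * N%:R * (3 * eL + 2 * eQ + 2 * eO + eC + eZ) <=
    2 * N%:R * (8 * fluctuation + 6 * `|ka| * K * D2).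
  by rewrite ler_wpM2l ?mulr_ge0 //; lra.
by have := D0; rewrite -!/(nedges a); lra.
Qed.

(** By exchange invariance both terms of
[swap_incr X i j * (F (swap i j X) - F X)] have the same mean, namely that of
[- swap_incr X i j * F X]; then sum over [i] and [j]. *)
Lemma stein_identity (F : {set 'I_N} -> R) :
  E (fun X => \sum_i \sum_j swap_incr X i j * (F (swap i j X) - F X)) =
  8 * (N%:R - 1) * E (fun X => centered_stat X * F X).
Proof.
have e1 i j : E (fun X => swap_incr X i j * (F (swap i j X) - F X)) =
    E (fun X => - 2 * (swap_incr X i j * F X)).
  have e2 : E (fun X => swap_incr X i j * F (swap i j X)) = E (fun X => - (swap_incr X i j * F X)).
    rewrite -(perm_E_swap m i j); apply: perm_E_eq => X _.
    have h1 := centered_stat_swap i j X; have h2 := centered_stat_swap i j (swap i j X).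
    rewrite !swapK in h2 *.
    have -> : swap_incr (swap i j X) i j = - swap_incr X i j.
      by move: h2; rewrite h1 => h; apply/eqP; rewrite -addr_eq0 -(inj_eq (addrI (centered_stat X)));
         rewrite addr0 {2}h; apply/eqP; ring.
    by rewrite mulNr.
  rewrite (_ : E (fun X => swap_incr X i j * (F (swap i j X) - F X)) =
    E (fun X => swap_incr X i j * F (swap i j X) - swap_incr X i j * F X)); last first.
    by apply: perm_E_eq => X _; rewrite mulrBr.
  rewrite perm_EB e2 perm_EN perm_EZ; ring.
rewrite perm_E_sum; under eq_bigr do rewrite perm_E_sum.
under eq_bigr do under eq_bigr do rewrite e1.
under eq_bigr do rewrite -perm_E_sum.
rewrite -perm_E_sum -perm_EZ; apply: perm_E_eq => X Xm.
under eq_bigr do rewrite -mulr_sumr.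
rewrite -mulr_sumr; under eq_bigr do rewrite -mulr_suml.
rewrite -mulr_suml sum_swap_incr //; ring.
Qed.

Definition sigma2 : R := E (fun X => centered_stat X ^+ 2).
Local Notation sg := (Num.sqrt sigma2).

(** Stein identity for the statistic itself. *)
Lemma E_sum_swap_incr_sqr :
  E (fun X => \sum_i \sum_j swap_incr X i j ^+ 2) = 8 * (N%:R - 1) * sigma2.
Proof.
rewrite /sigma2 -(perm_E_eq (fun X _ => esym (expr2 (centered_stat X)))) -stein_identity.
apply: perm_E_eq => X _; apply: eq_bigr => i _; apply: eq_bigr => j _.
by rewrite centered_stat_swap addrAC subrr add0r expr2.
Qed.

Lemma sigma2_near : `|8 * (N%:R - 1) * (sigma2 - v ^+ 2 * g)| <= E (fun X => `|increment_dev X|).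
Proof.
apply: le_trans (perm_E_norm _ _); rewrite le_eqVlt; apply/orP; left; apply/eqP.
by rewrite /increment_dev perm_EB E_sum_swap_incr_sqr perm_E_cst //; congr `|_|; ring.
Qed.

(** Multiplying the Stein equation by [8 (N - 1) sigma2] and replacing
[E (V f(W))] by means of [stein_identity], the increments of [f] are expanded to
first order.  The first-order terms give the sum of the squared increments,
whose mean is [8 (N - 1) sigma2]; the remainders are of third order. *)
Lemma stein_bound (f f' h : R -> R) (B c : R) : 0 <= B ->
  (forall z, f' z - z * f z = h z - c) ->
  (forall z z', `|f' z| <= B /\ `|f z' - f z - f' z * (z' - z)| <= B * (z' - z) ^+ 2) ->
  0 < sigma2 ->
  8 * (N%:R - 1) * sigma2 * `|E (fun X => h (centered_stat X / sg)) - c| <=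
  B * (2 * E (fun X => `|increment_dev X|) + E (fun X => \sum_i \sum_j `|swap_incr X i j| ^+ 3) / sg).
Proof.
move=> B0 fE fB s0.
have sg0 : 0 < sg by rewrite sqrtr_gt0.
have sgn0 : sg != 0 by rewrite gt_eqF.
have sgE : sg ^+ 2 = sigma2 by rewrite sqr_sqrtr // ltW.
pose W X := centered_stat X / sg.
set M := 8 * (N%:R - 1).
have M0 : 0 < M by rewrite mulr_gt0 //; have := N12R; lra.
pose S X := \sum_i \sum_j swap_incr X i j ^+ 2.
pose C X := \sum_i \sum_j `|swap_incr X i j| ^+ 3.
have hc : E (fun X => h (W X)) - c = E (fun X => f' (W X)) - E (fun X => centered_stat X * f (W X)) / sg.
  have -> : E (fun X => h (W X)) = E (fun X => f' (W X) - sg^-1 * (centered_stat X * f (W X)) + c).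
    apply: perm_E_eq => X _.
    by rewrite -[h (W X)](subrK c) -fE /W; congr (_ - _ + _); rewrite mulrAC mulrC.
  by rewrite perm_ED perm_EB perm_EZ perm_E_cst // addrK [_ / sg]mulrC.
have h1 : `|M * E (fun X => centered_stat X * f (W X)) - E (fun X => f' (W X) * S X) / sg| <= B * E C / sigma2.
  rewrite -stein_identity [_ / sg]mulrC -(perm_EZ m sg^-1) -perm_EB.
  apply: le_trans (perm_E_norm _ _) _.
  rewrite -mulrA [E C / _]mulrC mulrA -perm_EZ; apply: perm_E_le => X _.
  rewrite /S /C !mulr_sumr -sumrB; apply: le_trans (ler_norm_sum _ _ _) _.
  apply: ler_sum => i _; rewrite !mulr_sumr -sumrB.
  apply: le_trans (ler_norm_sum _ _ _) _; apply: ler_sum => j _.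
  have [_] := fB (W X) (W (swap i j X)).
  have -> : W (swap i j X) - W X = swap_incr X i j / sg.
    by rewrite /W centered_stat_swap; ring.
  set D := swap_incr X i j => hf.
  have -> : D * (f (W (swap i j X)) - f (W X)) - sg^-1 * (f' (W X) * D ^+ 2) =
     D * (f (W (swap i j X)) - f (W X) - f' (W X) * (D / sg)) by field.
  rewrite normrM.
  apply: (le_trans (ler_wpM2l (normr_ge0 _) hf)).
  rewrite exprMn exprVn sgE -[D ^+ 2]real_normK ?num_real //.
  by rewrite le_eqVlt; apply/orP; left; apply/eqP; ring.
have h2 : `|E (fun X => f' (W X) * (M * sigma2 - S X))| <= B * (2 * E (fun X => `|increment_dev X|)).
  apply: le_trans (perm_E_norm _ _) _.
  apply: (@le_trans _ _ (E (fun X => B * (`|M * (sigma2 - v ^+ 2 * g)| + `|increment_dev X|)))).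
    apply: perm_E_le => X _; rewrite normrM; apply: ler_pM => //.
      by have [] := fB (W X) 0.
    apply: le_trans (ler_normB _ _); rewrite le_eqVlt; apply/orP; left; apply/eqP.
    by congr `|_|; rewrite /increment_dev /S /M; ring.
  rewrite perm_EZ perm_ED perm_E_cst // ler_wpM2l //.
  have := sigma2_near; rewrite -/M; lra.
rewrite -{1}(gtr0_norm (mulr_gt0 M0 s0)) -normrM hc.
have -> : M * sigma2 * (E (fun X => f' (W X)) - E (fun X => centered_stat X * f (W X)) / sg) =
   E (fun X => f' (W X) * (M * sigma2 - S X)) -
   sg * (M * E (fun X => centered_stat X * f (W X)) - E (fun X => f' (W X) * S X) / sg).
  have -> : E (fun X => f' (W X) * (M * sigma2 - S X)) =
     M * sigma2 * E (fun X => f' (W X)) - E (fun X => f' (W X) * S X).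
    by rewrite -(perm_EZ m (M * sigma2)) -perm_EB; apply: perm_E_eq => X _; ring.
  by move: (sg) sgn0 sgE => w w0 wE; rewrite -wE; field.
apply: le_trans (ler_normB _ _) _; rewrite [leRHS]mulrDr; apply: lerD => //.
rewrite normrM gtr0_norm //.
apply: le_trans (ler_wpM2l (ltW sg0) h1) _.
by rewrite le_eqVlt; apply/orP; left; apply/eqP;
  move: (sg) sgn0 sgE => w w0 wE; rewrite -wE; field.
Qed.

(** The two quantities that tend to 0 by hypothesis, and the resulting rate for
the deviation of the squared increments. *)
Definition degree_ratio : R := D2 / (g * Num.sqrt g).
Definition square_ratio : R := Sq / g ^+ 2.
Definition dev_rate : R :=
  4 * Num.sqrt (K * (degree_ratio + 256 * square_ratio)) + 50 * K * degree_ratio.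

Hypothesis g1 : 1 <= g.
Local Notation al := degree_ratio.
Local Notation be := square_ratio.
Local Notation rg := (Num.sqrt g).

Let rg1 : 1 <= rg. Proof. by rewrite -[1]sqrtr1 ler_wsqrtr. Qed.
Let rgE : rg ^+ 2 = g. Proof. by rewrite sqr_sqrtr. Qed.
(** A simple graph has at most [N ^+ 2] edges; this turns the terms [D2 / (N g)]
into [degree_ratio]. *)
Let rgN : rg <= N%:R.
Proof.
have h : 2 * g <= N%:R * N%:R.
  rewrite -sum_degree; apply: le_trans (_ : \sum_(i < N) N%:R <= _).
    by apply: ler_sum => i _; exact: degree_leN.
  by rewrite sumr_const card_ord -[leLHS]mulr_natl.
have N0 : 0 <= N%:R :> R by [].
rewrite -(ger0_norm N0) -sqrtr_sqr ler_wsqrtr // expr2; have := g0; lra.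
Qed.

Let D2E : D2 = al * (g * rg).
Proof. by rewrite /degree_ratio divfK // mulf_neq0 // gt_eqF //; [have := g1|have := rg1]; lra. Qed.
Let SqE : Sq = be * g ^+ 2.
Proof. by rewrite /square_ratio divfK // expf_neq0 // gt_eqF //; have := g1; lra. Qed.

Lemma degree_ratio_ge0 : 0 <= al.
Proof. by rewrite divr_ge0 // mulr_ge0 // sqrtr_ge0. Qed.
Lemma square_ratio_ge0 : 0 <= be.
Proof. by rewrite divr_ge0 // sqr_ge0. Qed.

Let M := 8 * (N%:R - 1) : R.
Let MN : 4 * N%:R <= M. Proof. by rewrite /M; have := N12R; lra. Qed.

Lemma E_increment_dev_rate : E (fun X => `|increment_dev X|) <= M * g * dev_rate.
Proof.
apply: le_trans E_increment_dev _.
have al0 := degree_ratio_ge0; have be0 := square_ratio_ge0.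
have K1 := K0; have KK : 0 <= K by lra.
have h1 : fluctuation <= g * Num.sqrt (K * (al + 256 * be)).
  have -> : g * Num.sqrt (K * (al + 256 * be)) = Num.sqrt (g ^+ 2 * (K * (al + 256 * be))).
    by rewrite (sqrtrM _ (sqr_ge0 g)) sqrtr_sqr ger0_norm.
  rewrite /fluctuation ler_wsqrtr // mulrCA ler_wpM2l // mulrDr SqE D2E.
  have : g * rg <= g ^+ 2.
    rewrite expr2 ler_wpM2l // -[leRHS]rgE expr2 ler_peMl //; have := rg1; lra.
  move=> h; have := ler_wpM2l al0 h; lra.
have h2 : K * D2 <= N%:R * (g * (K * al)).
  rewrite D2E; have : g * rg <= g * N%:R by rewrite ler_wpM2l.
  have a2 : 0 <= K * al by rewrite mulr_ge0.
  move=> h; have := ler_wpM2l a2 h; lra.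
have h3 := ler_wpM2l (ler0n R N) h1.
have r0 : 0 <= g * dev_rate.
  by rewrite mulr_ge0 // /dev_rate addr_ge0 // mulr_ge0 ?sqrtr_ge0 // mulr_ge0.
rewrite -[leRHS]mulrA; apply: le_trans (ler_wpM2r r0 MN).
rewrite /dev_rate; lra.
Qed.

Lemma E_swap_incr3_rate :
  E (fun X => \sum_i \sum_j `|swap_incr X i j| ^+ 3) <= M * (g * rg) * (225 * K * al).
Proof.
apply: le_trans E_swap_incr3 _; rewrite {1}D2E.
have z0 : 0 <= (g * rg) * (225 * K * al).
  apply: mulr_ge0; first by apply: mulr_ge0 => //; exact: sqrtr_ge0.
  by apply: mulr_ge0 degree_ratio_ge0; have := K0; lra.
rewrite -[leRHS]mulrA; apply: le_trans (ler_wpM2r z0 MN); lra.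
Qed.

Lemma sigma2_ge : (v ^+ 2 - dev_rate) * g <= sigma2.
Proof.
have := le_trans sigma2_near E_increment_dev_rate; rewrite normrM ger0_norm; last first.
  by have := N12R; lra.
have M0 : 0 < M by have := MN; have := N12R; lra.
rewrite -/M -mulrA ler_pM2l // ler_norml => /andP[h _]; lra.
Qed.

(** Here [w ^+ 2] is a lower bound for [sigma2 / g]. *)
Lemma stein_rate (f f' h : R -> R) (B c w : R) : 0 <= B ->
  (forall z, f' z - z * f z = h z - c) ->
  (forall z z', `|f' z| <= B /\ `|f z' - f z - f' z * (z' - z)| <= B * (z' - z) ^+ 2) ->
  0 < w -> w ^+ 2 <= v ^+ 2 - dev_rate ->
  `|E (fun X => h (centered_stat X / sg)) - c| <=
  B * (2 * dev_rate / w ^+ 2 + 225 * K * al / w ^+ 3).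
Proof.
move=> B0 fE fB w0 wv.
have al0 := degree_ratio_ge0; have K1 := K0.
have w20 : 0 < w ^+ 2 by rewrite exprn_gt0.
have gp : 0 < g by have := g1; lra.
have wg : w ^+ 2 * g <= sigma2.
  by apply: le_trans sigma2_ge; rewrite ler_pM2r.
have s0 : 0 < sigma2 by apply: lt_le_trans wg; rewrite mulr_gt0.
have wsg : w * rg <= sg.
  have -> : w * rg = Num.sqrt (w ^+ 2 * g).
    by rewrite (sqrtrM _ (sqr_ge0 w)) sqrtr_sqr gtr0_norm.
  by rewrite ler_wsqrtr.
have sg0 : 0 < sg by rewrite sqrtr_gt0.
have M0 : 0 < M by have := MN; have := N12R; lra.
have := stein_bound B0 fE fB s0; rewrite -/M; set err := `|_| => hb.
have err0 : 0 <= err by exact: normr_ge0.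
have hC : E (fun X => \sum_i \sum_j `|swap_incr X i j| ^+ 3) / sg <= M * g * (225 * K * al / w).
  rewrite ler_pdivrMr //; apply: le_trans E_swap_incr3_rate _.
  have -> : M * g * (225 * K * al / w) * sg = M * g * (225 * K * al) * (sg / w) by field; rewrite gt_eqF.
  have -> : M * (g * rg) * (225 * K * al) = M * g * (225 * K * al) * rg by ring.
  apply: ler_wpM2l; last by rewrite ler_pdivlMr // mulrC.
  apply: mulr_ge0; first by apply: mulr_ge0 => //; exact: ltW.
  by apply: mulr_ge0 => //; lra.
have h1 : M * (w ^+ 2 * g) * err <= M * sigma2 * err.
  by rewrite ler_wpM2r // ler_pM2l.
have h2 : M * (w ^+ 2 * g) * err <= B * (M * g * (2 * dev_rate + 225 * K * al / w)).
  apply: le_trans h1 (le_trans hb _); rewrite ler_wpM2l //.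
  have := E_increment_dev_rate; lra.
have Mg : 0 < M * g * w ^+ 2 by apply: mulr_gt0 => //; exact: mulr_gt0.
rewrite -(ler_pM2l Mg).
have -> : M * g * w ^+ 2 * err = M * (w ^+ 2 * g) * err by ring.
apply: (le_trans h2); rewrite le_eqVlt; apply/orP; left; apply/eqP.
by field; rewrite gt_eqF.
Qed.

End GraphStatistic.

Unset Implicit Arguments.

(** * The central limit theorem *)

Theorem theorem4 (R : realType) (m n : nat -> nat) (r : R)
    (G : forall N : nat, graph N)
    (hmn : forall N : nat, (m N + n N)%N = N)
    (hr : 0 < r < 1)
    (hm : ((m N)%:R / N%:R @[N --> \oo] --> r)%classic)
    (hG : forall N : nat, simple_graph (G N))
    (hdeg : is_little_o
       (fun N : nat => \sum_(i < N) (#|incident (G N) i|%:R : R) ^+ 2)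
       (fun N : nat => #|G N|%:R `^ (3 / 2)))
    (hsq : is_little_o
       (fun N : nat => (num_squares (G N))%:R : R)
       (fun N : nat => #|G N|%:R ^+ 2)) :
  cvg_in_distribution
    (fun (N : nat) (t : R) =>
       perm_Pr R (m N) (fun X => Z_w R (m N) (n N) (G N) X <= t))
    (normal_prob 0 1).
Proof.
have [_ {}hdeg] := hdeg.
have [hsq0 {}hsq] := hsq.
pose al N := degree_ratio R (G N).
pose be N := square_ratio R (G N).
have alE N : al N = (\sum_(i < N) (#|incident (G N) i|%:R : R) ^+ 2) / #|G N|%:R `^ (3 / 2).
  rewrite /al /degree_ratio (nedgesE R (hG N)); congr (_ / _).
    by apply: eq_bigr => i _; rewrite (degreeE R (hG N)).
  have [->|g0] := eqVneq (#|G N|%:R : R) 0; first by rewrite mul0r powR0 //; lra.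
  rewrite (_ : 3 / 2 = 1 + 2^-1); last by lra.
  rewrite powRD; last by rewrite g0 implybT.
  by rewrite powRr1 // powR12_sqrt.
have {hdeg}hal : (al N @[N --> \oo] --> (0 : R))%classic.
  by have -> := funext alE.
have {hsq}hbe : (be N @[N --> \oo] --> (0 : R))%classic.
  rewrite (_ : be = fun N => (num_squares (G N))%:R / #|G N|%:R ^+ 2) //.
  by apply/funext => N; rewrite /be /square_ratio (nedgesE R (hG N)).
pose de N := dev_rate R (G N).
have hde : (de N @[N --> \oo] --> (0 : R))%classic.
  have -> : (0 : R) = 4 * Num.sqrt (slice_const R * (0 + 256 * 0)) + 50 * slice_const R * 0.
    by rewrite !(mulr0, addr0) sqrtr0 mulr0.
  apply: cvgD; last by apply: cvgM => //; exact: cvg_cst.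
  apply: cvgM; first exact: cvg_cst.
  apply: continuous_cvg; first exact: sqrt_continuous.
  apply: cvgM; first exact: cvg_cst.
  apply: cvgD => //.
  by apply: cvgM => //; exact: cvg_cst.
pose v N := prob1 R N (m N) * (1 - prob1 R N (m N)).
have hv : (v N @[N --> \oo] --> r * (1 - r))%classic.
  by apply: cvgM => //; apply: cvgB => //; exact: cvg_cst.
set w0 := r * (1 - r) in hv.
have w0p : 0 < w0 by case/andP: hr => r0 r1; rewrite mulr_gt0 // subr_gt0.
(* half the limit of v leaves room for dev_rate in the lower bound on the
   variance *)
pose w := w0 / 2.
have wp : 0 < w by rewrite divr_gt0.
pose er N := 2 * de N / w ^+ 2 + 225 * slice_const R * al N / w ^+ 3.
have her : (er N @[N --> \oo] --> (0 : R))%classic.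
  have -> : (0 : R) = 2 * 0 / w ^+ 2 + 225 * slice_const R * 0 / w ^+ 3.
    by rewrite !mulr0 !mul0r addr0.
  apply: cvgD; (apply: cvgM; last exact: cvg_cst); by apply: cvgM => //; exact: cvg_cst.
have hw : (\forall N \near \oo, w ^+ 2 <= v N ^+ 2 - de N)%classic.
  have h : (v N ^+ 2 - de N @[N --> \oo] --> w0 ^+ 2 - 0)%classic.
    by apply: cvgB => //; apply: cvgM.
  have : w ^+ 2 < w0 ^+ 2 - 0 by rewrite subr0 /w exprMn; nra.
  move=> hlt; near=> N; apply: ltW; near: N; exact: (cvgr_gt _ h).
pose Zc N X := centered_stat R (m N) (G N) X / Num.sqrt (sigma2 R (m N) (G N)).
have stein (a b : R) : a < b -> exists (h : R -> R) (c : R),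
    [/\ Phi a <= c <= Phi b, forall x : R, (x <= a)%R%:R <= h x <= (x <= b)%R%:R &
      (perm_E (m N) (fun X => h (Zc N X)) @[N --> \oo] --> c)%classic].
  move=> ab; have [h [f [f' [c [B [B0 cb hb fE fB]]]]]] := stein_solution ab.
  exists h, c; split => //.
  have herB : (B * er N @[N --> \oo] --> (0 : R))%classic.
    by rewrite -(mulr0 B); apply: cvgM => //; exact: cvg_cst.
  apply/cvgrPdist_le => e e0; near=> N.
  rewrite distrC; apply: (@le_trans _ _ (B * er N)); last first.
    by near: N; exact: (cvgr_le _ herB).
  have N12 : (12 <= N)%N by near: N; exact: nbhs_infty_ge.
  have g1 : 1 <= nedges (adj R (G N)).
    rewrite (nedgesE R (hG N)) (ler_nat _ 1) lt0n -(pnatr_eq0 R).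
    have : #|G N|%:R ^+ 2 != 0 :> R by near: N; exact: hsq0.
    by rewrite expf_eq0 /=.
  have hwN : w ^+ 2 <= v N ^+ 2 - de N by near: N; exact: hw.
  exact: (stein_rate (hmn N) N12 (hG N) g1 B0 fE fB wp hwN).
have PrE N t : (12 <= N)%N -> perm_Pr R (m N) (fun X => Z_w R (m N) (n N) (G N) X <= t) =
   perm_E (m N) (fun X => (Zc N X <= t)%R%:R).
  move=> N12; apply: perm_E_eq => X Xm; rewrite /Z_w /Zc.
  by rewrite (R_w_centered R (hmn N) N12 (hG N) Xm) (perm_Var_R_w R (hmn N) N12 (hG N)).
move=> t _; rewrite -/Phi.
have cPhi := @continuous_Phi R t.
apply/cvgrPdist_le => e e0.
have [d d0 hd] : exists2 d : R, 0 < d & forall y, `|t - y| <= d -> `|Phi t - Phi y| <= e / 2.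
  have /cvgrPdist_le/(_ (e / 2)) := cPhi; rewrite divr_gt0 // => /(_ isT).
  move=> /nbhs_ballP[d /= d0 hd]; exists (d / 2); first by rewrite divr_gt0.
  move=> y yd; apply: hd; rewrite /ball /=; apply: le_lt_trans yd _; lra.
have [h1 [c1 [c1b h1b h1c]]] := stein t (t + d) ltac:(lra).
have [h2 [c2 [c2b h2b h2c]]] := stein (t - d) t ltac:(lra).
have p1 : Phi (t + d) <= Phi t + e / 2.
  have := hd (t + d); rewrite opprD addrA subrr sub0r normrN gtr0_norm // lexx.
  by move=> /(_ isT); rewrite ler_norml => /andP[]; lra.
have p2 : Phi t - e / 2 <= Phi (t - d).
  have := hd (t - d); rewrite subKr gtr0_norm // lexx.
  by move=> /(_ isT); rewrite ler_norml => /andP[]; lra.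
have e20 : 0 < e / 2 by rewrite divr_gt0.
move/cvgrPdist_le : h1c => /(_ _ e20) h1c; move/cvgrPdist_le : h2c => /(_ _ e20) h2c.
near=> N.
have N12 : (12 <= N)%N by near: N; exact: nbhs_infty_ge.
rewrite PrE //.
have q1 : perm_E (m N) (fun X => (Zc N X <= t)%R%:R) <= perm_E (m N) (fun X => h1 (Zc N X)).
  by apply: perm_E_le => X _; case/andP: (h1b (Zc N X)).
have q2 : perm_E (m N) (fun X => h2 (Zc N X)) <= perm_E (m N) (fun X => (Zc N X <= t)%R%:R).
  by apply: perm_E_le => X _; case/andP: (h2b (Zc N X)).
have r1 : `|c1 - perm_E (m N) (fun X => h1 (Zc N X))| <= e / 2.
  by near: N; exact: h1c.
have r2 : `|c2 - perm_E (m N) (fun X => h2 (Zc N X))| <= e / 2.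
  by near: N; exact: h2c.
move: r1 r2; rewrite !ler_norml => /andP[? ?] /andP[? ?].
case/andP: c1b => ? ?; case/andP: c2b => ? ?.
by apply/andP; split; lra.
Unshelve. all: by end_near. Qed.
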